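(* Let $q\geq 4$ be a power of a prime and let $n\geq 2$ be an integer. Then the graph $\mathcal{HGL}_n(\mathbb{F}_{q^2})$ is a core, i.e. every endomorphism of $\mathcal{HGL}_n(\mathbb{F}_{q^2})$ is an automorphism.
   Context: $\mathbb{F}_{q^2}$ is the finite field with $q^2$ elements, with the involution $\overline{x}=x^q$. An $n\times n$ matrix $A$ over $\mathbb{F}_{q^2}$ is hermitian if $A^{\ast}:=\overline{A}^{\top}=A$, where the involution is applied entry-wise. $\mathcal{HGL}_n(\mathbb{F}_{q^2})$ denotes both the set of all invertible $n\times n$ hermitian matrices over $\mathbb{F}_{q^2}$ and the (simple, undirected) graph with this vertex set in which $A,B$ are joined by an edge if and only if $\mathrm{rank}(A-B)=1$. An endomorphism of a graph $\Gamma$ is a map $\Phi:V(\Gamma)\to V(\Gamma)$ (not assumed bijective) such that $\{\Phi(u),\Phi(v)\}$ is an edge whenever $\{u,v\}$ is an edge; an automorphism is a bijective endomorphism whose inverse is also an endomorphism. A graph is a core if all its endomorphisms are automorphisms. *)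

(* Defs.v *)
From HB Require Import structures.
From mathcomp Require Import all_boot all_order all_algebra.

Set Implicit Arguments.
Unset Strict Implicit.
Unset Printing Implicit Defensive.

Import GRing.Theory.
Local Open Scope ring_scope.

Record sgraph := SGraph {
  vertex :> Type;
  edge : rel vertex;
  edge_sym : symmetric edge;
  edge_irr : irreflexive edge }.

Definition endomorphism (G : sgraph) (f : G -> G) : Prop :=
  forall u v : G, edge u v -> edge (f u) (f v).

Definition automorphism (G : sgraph) (f : G -> G) : Prop :=
  endomorphism f /\
  exists g : G -> G, [/\ cancel f g, cancel g f & endomorphism g].

Definition is_core (G : sgraph) : Prop :=
  forall f : G -> G, endomorphism f -> automorphism f.

(* [q] is a free parameter here; [x ^+ q] is the involution of the field with
   q^2 elements only under the hypothesis #|F| = q ^ 2. *)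
Definition conj_trmx (F : fieldType) (q m n : nat) (A : 'M[F]_(m, n)) :
    'M[F]_(n, m) :=
  (map_mx (fun x : F => x ^+ q) A)^T.

Definition hermitian (F : fieldType) (q n : nat) : pred 'M[F]_n :=
  fun A => conj_trmx q A == A.

Definition HGL_vertex (F : fieldType) (q n : nat) : Type :=
  {A : 'M[F]_n | hermitian q A && (A \in unitmx)}.

Definition HGL_edge (F : fieldType) (q n : nat) : rel (HGL_vertex F q n) :=
  fun A B => \rank (val A - val B) == 1%N.

Lemma HGL_edge_sym (F : fieldType) (q n : nat) : symmetric (@HGL_edge F q n).
Proof. by move=> A B; rewrite /HGL_edge -mxrank_opp opprB. Qed.

Lemma HGL_edge_irr (F : fieldType) (q n : nat) : irreflexive (@HGL_edge F q n).
Proof. by move=> A; rewrite /HGL_edge subrr mxrank0. Qed.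

Definition HGL (F : fieldType) (q n : nat) : sgraph :=
  SGraph (@HGL_edge_sym F q n) (@HGL_edge_irr F q n).

(* Main.v *)
From HB Require Import structures.
From mathcomp Require Import all_boot all_order all_algebra all_field.
From mathcomp Require Import ring zify.
Require Import Defs.

Set Implicit Arguments.
Unset Strict Implicit.
Unset Printing Implicit Defensive.

Import GRing.Theory.

(** Let K be the fixed field of the involution bar, so that K has q elements,
  and write [x] for the rank-one hermitian matrix x (star x).  A neighbour of a
  vertex A has the form A + s[x] with s in K, and its determinant is
  det A (1 + s g(x)) with g(x) = (star x) A^-1 x.  So the maximal clique
  {A + s[x]} has q vertices, all of the same determinant, when x is isotropic
  (g(x) = 0); otherwise it loses one point, and its q - 1 vertices have distinct
  determinants.

  An endomorphism phi maps cliques with q vertices onto cliques with q vertices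
  (phi_iso_adj), hence it preserves the relation iso_adj: adjacent and of equal
  determinant.  The proof is a study of phi on this subgraph.

  The heart is local injectivity: phi does not identify two iso_adj-neighbours of
  a vertex (phi_local_inj).  If it did, two isotropic lines through A, in
  directions x and y, would be mapped into one clique L of size q.  Restrict phi
  to the matrices A + (hermitian matrix supported on x, y); it contains a copy of
  the graph of nonsingular 2 x 2 hermitian matrices, which are studied as
  triples.  The preimage of L is closed in a strong sense: it contains all common
  neighbours of two of its points that have different images.  For q >= 4 there
  is enough room on each line to propagate this closure from two isotropic lines
  to the whole 2 x 2 graph (maps_star_of_two_lines, full_image).  Then phi would be a
  proper colouring of the 2 x 2 graph with q colours.  No such colouring exists
  (no_colouring): a colour class together with the zero matrix is a set of
  hermitian 2 x 2 matrices with nonsingular differences, and such a set is too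
  small for q of them to cover all vertices (coclique_bound).

  The rest is counting.  The set of vertices with a given determinant is connected
  by iso_adj (det_class_connected), all these classes have the same size, and the
  iso_adj-degree is constant because congruence acts transitively.  So a locally
  injective phi maps each class bijectively onto a class and is an isomorphism
  between the induced graphs (phi_nbrs, phi_class_inj).  Finally, two classes
  cannot have the same image: if phi B = phi C with different determinants, then
  every neighbour of C in the class of B would also be a neighbour of B, which
  linear algebra excludes (no_twin_in_other_class).  Hence phi is injective, and
  an injective endomorphism of a finite graph is an automorphism. *)

(** * Determinants, ranks, roots and finite sets *)

Section Generalities.

Local Open Scope ring_scope.

Lemma det_1_addC (R : comUnitRingType) m n (X : 'M[R]_(m, n)) (Y : 'M[R]_(n, m)) :
  \det (1%:M + X *m Y) = \det (1%:M + Y *m X).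
Proof.
pose P := block_mx 1%:M X 0 1%:M; pose Q := block_mx 1%:M (- X) Y 1%:M.
have e1 : P *m Q = block_mx (1%:M + X *m Y) 0 Y 1%:M.
  by rewrite mulmx_block !mul1mx !mul0mx !mulmx1 add0r addrC addNr add0r.
have e2 : Q *m P = block_mx 1%:M 0 Y (1%:M + Y *m X).
  by rewrite mulmx_block !mul1mx !mulmx0 !mulmx1 !addr0 subrr [_ + 1%:M]addrC.
have := det_mulmx P Q; have := det_mulmx Q P.
by rewrite e1 e2 !det_lblock !det1 mul1r mulr1 mulrC => -> ->.
Qed.

Lemma det_mx2 (R : comNzRingType) (M : 'M[R]_(1 + 1)) :
  \det M = ulsubmx M 0 0 * drsubmx M 0 0 - ursubmx M 0 0 * dlsubmx M 0 0.
Proof.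
rewrite (expand_det_row _ 0) !big_ord_recl big_ord0 /cofactor !det_mx11 !mxE /=.
rewrite !addr0 /bump /= expr0 expr1 mul1r mulN1r mulrN.
by congr (M _ _ * M _ _ - M _ _ * M _ _); apply/val_inj.
Qed.

Lemma rank1_outer (F : fieldType) m n (A : 'M[F]_(m, n)) :
  (\rank A <= 1)%N -> exists (c : 'cV_m) (r : 'rV_n), A = c *m r.
Proof.
move=> rA; have [->|A0] := eqVneq A 0; first by exists 0, 0; rewrite mul0mx.
have /submxP[c ->] : (A <= nz_row A)%MS.
  rewrite -(geq_leqif (mxrank_leqif_sup (nz_row_sub A))) rank_rV.
  by rewrite nz_row_eq0 A0.
by exists c, (nz_row A).
Qed.

Lemma card_roots (F : finFieldType) (p : {poly F}) d :
  p != 0 -> (size p <= d.+1)%N -> (#|[set x | root p x]| <= d)%N.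
Proof.
move=> p0 sp; rewrite -ltnS cardE; apply: leq_trans sp.
apply: max_poly_roots => //; last exact: enum_uniq.
by apply/allP => x; rewrite mem_enum inE.
Qed.

Lemma sum_fibres (T U : finType) (A : {set T}) (B : {set U}) (f : T -> U) :
  (forall x, x \in A -> f x \in B) ->
  #|A| = (\sum_(b in B) #|[set x in A | f x == b]|)%N.
Proof.
move=> fAB; rewrite -sum1_card (partition_big f (mem B)) //=.
apply: eq_bigr => b _; rewrite -sum1_card; apply: eq_bigl => x; by rewrite inE.
Qed.

(** A map whose fibres have at most m points, from a set with at least k m points
  to a set with at most k points, is onto with all fibres of size m.  This turns the
  bounds on numbers of roots below into exact counts. *)
Lemma fibres_tight (T U : finType) (A : {set T}) (B : {set U}) (f : T -> U) m k :
  (forall x, x \in A -> f x \in B) ->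
  (forall b, b \in B -> #|[set x in A | f x == b]| <= m)%N ->
  (#|B| <= k)%N -> (#|A| >= k * m)%N -> (0 < m)%N ->
  #|B| = k /\ forall b, b \in B -> #|[set x in A | f x == b]| = m.
Proof.
move=> fAB fm Bk Akm m0.
have sA := sum_fibres fAB.
have le : (#|A| <= #|B| * m)%N.
  by rewrite sA -sum_nat_const; apply: leq_sum => b bB; apply: fm.
have Bk' : #|B| = k.
  by apply/eqP; rewrite eqn_leq Bk -(leq_pmul2r m0); apply: leq_trans Akm le.
split=> // b bB; apply/eqP; rewrite eqn_leq fm //= leqNgt; apply/negP => lt.
suff : (#|A| < k * m)%N by rewrite ltnNge Akm.
rewrite sA -Bk' -sum_nat_const (bigD1 b) //= [X in (_ < X)%N](bigD1 b) //=.
by rewrite -addSn leq_add // leq_sum // => c /andP[cB _]; apply: fm.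
Qed.

End Generalities.

(** f acts injectively on the finite set of edges, so every edge is the image of an
  edge; this is why the inverse also preserves adjacency. *)
Lemma finite_endo_auto (T : finType) (e : rel T) (f : T -> T) : injective f ->
  (forall u v, e u v -> e (f u) (f v)) ->
  exists g, [/\ cancel f g, cancel g f & forall u v, e u v -> e (g u) (g v)].
Proof.
move=> f_inj f_hom; have [g fK gK] := injF_bij f_inj; exists g; split=> //.
pose E := [set p | e p.1 p.2]; pose ff (p : T * T) := (f p.1, f p.2).
have ff_inj : injective ff by move=> [a b] [c d] [/f_inj-> /f_inj->].
have EE : ff @: E = E.
  apply/eqP; rewrite eqEcard card_imset // leqnn andbT.
  by apply/subsetP => _ /imsetP[p + ->]; rewrite !inE; apply: f_hom.
move=> u v uv; have : (u, v) \in ff @: E by rewrite EE inE.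
by case/imsetP=> -[a b]; rewrite inE /= => ab [-> ->]; rewrite !fK.
Qed.

(** * The involution of the field with q^2 elements *)

(** The q-th power map is an iterate of the Frobenius automorphism, since q is a
  power of the characteristic. *)
Lemma power_involution (F : finFieldType) (q : nat) :
  (exists p k : nat, [/\ prime p, 0 < k & q = p ^ k]) -> #|F| = q ^ 2 ->
  exists bar : {rmorphism F -> F}, forall x, bar x = (x ^+ q)%R.
Proof.
case=> p [k [p_pr _ ->]]; rewrite -expnM => /card_finPcharP/(_ p_pr) chF.
elim: k => [|k [b bE]]; first by exists idfun => x; rewrite expn0 expr1.
exists (pFrobenius_aut chF \o b) => x.
by rewrite /= pFrobenius_autE bE -exprM expnSr.
Qed.

Section QuadraticInvolution.

Local Open Scope ring_scope.

Variables (F : finFieldType) (q : nat) (bar : {rmorphism F -> F}).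
Hypothesis barE : forall x, bar x = x ^+ q.
Hypothesis cardF : #|F| = (q ^ 2)%N.
Hypothesis q_ge4 : (4 <= q)%N.

Lemma barK : involutive bar.
Proof. by move=> x; rewrite !barE -exprM mulnn -cardF expf_card. Qed.

Definition fixf : {set F} := [set x | bar x == x].
Definition nrm (x : F) := x * bar x.

Lemma fixfP x : reflect (bar x = x) (x \in fixf).
Proof. by rewrite inE; apply: eqP. Qed.

Lemma bar_nrm x : bar (nrm x) = nrm x.
Proof. by rewrite /nrm rmorphM /= barK mulrC. Qed.

Lemma fixf0 : 0 \in fixf.
Proof. by apply/fixfP; rewrite rmorph0. Qed.

Lemma fixfD x y : x \in fixf -> y \in fixf -> x + y \in fixf.
Proof. by move=> /fixfP xK /fixfP yK; apply/fixfP; rewrite rmorphD /= xK yK. Qed.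

Lemma fixfN x : x \in fixf -> - x \in fixf.
Proof. by move=> /fixfP xK; apply/fixfP; rewrite rmorphN /= xK. Qed.

Lemma fixfM x y : x \in fixf -> y \in fixf -> x * y \in fixf.
Proof. by move=> /fixfP xK /fixfP yK; apply/fixfP; rewrite rmorphM /= xK yK. Qed.

Lemma fixfV x : x \in fixf -> x^-1 \in fixf.
Proof. by move=> /fixfP xK; apply/fixfP; rewrite fmorphV /= xK. Qed.

Lemma fixf1 : 1 \in fixf. Proof. by apply/fixfP; rewrite rmorph1. Qed.

Lemma nrm_fixf x : nrm x \in fixf.
Proof. by apply/fixfP/bar_nrm. Qed.

Lemma tr_fixf x : x + bar x \in fixf.
Proof. by apply/fixfP; rewrite rmorphD /= barK addrC. Qed.

Lemma nrm_eq0 x : (nrm x == 0) = (x == 0).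
Proof. by rewrite /nrm mulf_eq0 fmorph_eq0 orbb. Qed.

(** Since bar t = t^q, the left-hand side is a polynomial of degree at most q + 1.
  Restricted to an affine line w + t z, a hermitian form is such an expression, so
  this is the bound behind every choice of a generic vector. *)
Lemma card_bar_roots (c0 c1 c2 c3 : F) :
  [|| c0 != 0, c1 != 0, c2 != 0 | c3 != 0] ->
  (#|[set t | c0 + c1 * t + c2 * bar t + c3 * (t * bar t) == 0]%R| <= q.+1)%N.
Proof.
move=> nz; pose p : {poly F} := c0%:P + c1 *: 'X + c2 *: 'X^q + c3 *: 'X^(q.+1).
have pE i : p`_i = c0 *+ (i == 0%N) + c1 *+ (i == 1%N) + c2 *+ (i == q) + c3 *+ (i == q.+1).
  by rewrite !coefD coefC !coefZ coefX !coefXn !mulr_natr; case: (i == 0%N).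
have [q0 q1 qS] : [/\ (q == 0%N) = false, (q == 1%N) = false & (q == q.+1) = false].
  by split; apply/negbTE; lia.
have p0 : p != 0.
  apply/eqP => pz; move: (pE 0%N) (pE 1%N) (pE q) (pE q.+1); rewrite pz !coef0.
  rewrite !eqSS !eqxx !(eq_sym _ q) !q0 !q1 qS /= !mulr0n !mulr1n !addr0 !add0r.
  by move=> e0 e1 e2 e3; move: nz; rewrite -e0 -e1 -e2 -e3 eqxx.
have sp : (size p <= q.+2)%N.
  apply/leq_sizeP => j jq; rewrite pE.
  rewrite [(j == q)]gtn_eqF ?[(j == q.+1)]gtn_eqF; try lia.
  rewrite ?[(j == 0%N)]gtn_eqF ?[(j == 1%N)]gtn_eqF; try lia.
  by rewrite !mulr0n !addr0.
apply: leq_trans (card_roots p0 sp); apply/subset_leq_card/subsetP => t; rewrite !inE.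
rewrite !barE /root !(hornerD, hornerC, hornerZ, hornerX, hornerXn) exprS => /eqP <-.
by apply/eqP; ring.
Qed.

Lemma card_fixf_le : (#|fixf| <= q)%N.
Proof.
pose p : {poly F} := 'X^q - 'X.
have sp : size p = q.+1.
  by rewrite /p size_polyDl size_polyXn // size_polyN size_polyX; lia.
have p0 : p != 0 by rewrite -size_poly_eq0 sp.
apply: leq_trans (card_roots p0 _); last by rewrite sp.
apply/subset_leq_card/subsetP => t; rewrite !inE /root !hornerE barE => /eqP ->.
by rewrite subrr.
Qed.

Lemma card_tr_le (c : F) : (#|[set x : F | x + bar x == c]%R| <= q)%N.
Proof.
pose p : {poly F} := 'X^q + ('X - c%:P).
have sp : size p = q.+1.
  by rewrite /p size_polyDl size_polyXn // size_XsubC; lia.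
have p0 : p != 0 by rewrite -size_poly_eq0 sp.
apply: leq_trans (card_roots p0 _); last by rewrite sp.
apply/subset_leq_card/subsetP => t.
rewrite !inE /root barE !(hornerD, hornerN, hornerC, hornerX, hornerXn) => /eqP <-.
by apply/eqP; ring.
Qed.

Lemma card_nrm_le c : c != 0 -> (#|[set x : F | nrm x == c]| <= q.+1)%N.
Proof.
move=> c0; have := @card_bar_roots (- c) 0 0 1; rewrite oppr_eq0 c0 => /(_ isT).
apply: leq_trans; apply/subset_leq_card/subsetP => t; rewrite !inE => /eqP <-.
by apply/eqP; rewrite /nrm; ring.
Qed.

Lemma card_tr_fixf :
  #|fixf| = q /\ forall c, c \in fixf -> #|[set x : F | x + bar x == c]| = q.
Proof.
have [|||||-> H] := @fibres_tight F F setT fixf (fun x => x + bar x) q q.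
- by move=> x _; apply: tr_fixf.
- move=> b _; apply: leq_trans (card_tr_le b).
  by apply/subset_leq_card/subsetP => x; rewrite !inE.
- exact: card_fixf_le.
- by rewrite cardsT cardF mulnn.
- lia.
split=> // c /H <-; apply: eq_card => x; by rewrite !inE.
Qed.

Lemma card_fixf : #|fixf| = q. Proof. by case: card_tr_fixf. Qed.

Lemma card_tr c : c \in fixf -> #|[set x : F | x + bar x == c]| = q.
Proof. by case: card_tr_fixf => _; apply. Qed.

Lemma card_nrm c : c \in fixf -> c != 0 -> #|[set x : F | nrm x == c]| = q.+1.
Proof.
have [|||||_ H] := @fibres_tight F F (setT :\ 0) (fixf :\ 0) nrm q.+1 q.-1.
- by move=> x; rewrite !inE andbT -nrm_eq0 => -> /=; apply/eqP/bar_nrm.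
- move=> b; rewrite !inE => /andP[b0 _]; apply: leq_trans (card_nrm_le b0).
  by apply/subset_leq_card/subsetP => x; rewrite !inE => /andP[].
- by move: (cardsD1 0 fixf); rewrite fixf0 card_fixf add1n => e; rewrite -ltnS -e prednK; lia.
- move: (cardsD1 (0 : F) setT); rewrite in_setT cardsT cardF -mulnn add1n => e.
  by rewrite -ltnS -e; case: (q) q_ge4 => // r _; rewrite /= ; nia.
- lia.
move=> cK c0; rewrite -(H c) ?in_setD1 ?c0 //; apply: eq_card => x; rewrite !inE.
by rewrite andbT; case: (nrm x =P c) => [e|]; rewrite ?andbF // andbT -nrm_eq0 e c0.
Qed.

Lemma trace_surj c : c \in fixf -> exists x, x + bar x = c.
Proof.
move=> /card_tr cq.
have /card_gt0P[x] : (0 < #|[set x : F | x + bar x == c]%R|)%N by rewrite cq; lia.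
by rewrite inE => /eqP; exists x.
Qed.

Lemma nrm_surj c : c \in fixf -> exists x, nrm x = c.
Proof.
move=> cK; have [->|c0] := eqVneq c 0; first by exists 0; rewrite /nrm mul0r.
have /card_gt0P[x] : (0 < #|[set x : F | nrm x == c]%R|)%N by rewrite card_nrm.
by rewrite inE => /eqP; exists x.
Qed.

(** K has at least 4 elements, so one of them avoids zero and two further values.
  This is how q >= 4 enters the propagation argument. *)
Lemma fixf_avoid (P Q : pred F) :
  {in fixf &, forall s t, P s -> P t -> s = t} ->
  {in fixf &, forall s t, Q s -> Q t -> s = t} ->
  exists s, [/\ s \in fixf, s != 0, ~~ P s & ~~ Q s].
Proof.
have uniq1 (R : pred F) : {in fixf &, forall s t, R s -> R t -> s = t} ->
    (#|[set s in fixf | R s]| <= 1)%N.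
  move=> RK; rewrite leqNgt; apply/negP => /card_gt1P[s [t]].
  by case=> /setIdP[sK sR] /setIdP[tK tR] /eqP; apply; apply: RK.
move=> /uniq1 P1 /uniq1 Q1.
pose good := fixf :\: (0 |: ([set s in fixf | P s] :|: [set s in fixf | Q s])).
have /card_gt0P[s] : (0 < #|good|)%N.
  rewrite cardsD card_fixf subn_gt0; apply: leq_ltn_trans (subset_leq_card (subsetIr _ _)) _.
  rewrite cardsU1; apply: leq_ltn_trans (leq_add (leq_b1 _) (leq_of_leqif (leq_card_setU _ _))) _.
  lia.
rewrite !inE => /andP[/norP[s0 /norP[nP nQ]] sK]; exists s; split=> //.
- by rewrite inE.
- by apply: contra nP => ->; rewrite sK.
- by apply: contra nQ => ->; rewrite sK.
Qed.

Local Notation K := fixf.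
Local Notation N := nrm.

(** * Hermitian 2 x 2 matrices *)

Section BinaryForms.

Local Notation vec := (F * F)%type.
Local Notation form := (F * F * F)%type.

Implicit Types (v u w : form) (x y z : vec) (a b s t : F).

(** A triple (a, g, b) stands for the hermitian matrix with rows (a, g) and
  (bar g, b), where a and b lie in K. *)
Definition herm2 v := (v.1.1 \in K) && (v.2 \in K).
Definition det2 v := v.1.1 * v.2 - N v.1.2.

(** The matrix s[x]. *)
Definition ray s x : form := (s * N x.1, s * (x.1 * bar x.2), s * N x.2).

(** (star x) adj(v) x: the rate of change of the determinant along the line of v in
  direction x.  When v is nonsingular it vanishes exactly at the isotropic
  directions of v. *)
Definition slope v x :=
  v.1.1 * N x.2 + v.2 * N x.1 - (v.1.2 * bar x.1 * x.2 + bar v.1.2 * x.1 * bar x.2).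

(** The norm of the determinant of the matrix with columns x and y: zero exactly when
  x and y are proportional. *)
Definition wedge x y := N (x.1 * y.2 - x.2 * y.1).

Lemma det2_ray s x : s \in K -> det2 (ray s x) = 0.
Proof.
move=> /fixfP sK; rewrite /det2 /ray /= /nrm !rmorphM /= barK sK; ring.
Qed.

Lemma det2_addray v s x : s \in K -> det2 (v + ray s x) = det2 v + s * slope v x.
Proof.
move=> /fixfP sK; rewrite /det2 /ray /slope /= /nrm !(rmorphD, rmorphM) /= barK sK; ring.
Qed.

Lemma slopeD u v x : slope (u + v) x = slope u x + slope v x.
Proof. rewrite /slope /= !rmorphD /=; ring. Qed.

Lemma slopeN u x : slope (- u) x = - slope u x.
Proof. rewrite /slope /= !rmorphN /=; ring. Qed.

Lemma wedgeC x y : wedge x y = wedge y x.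
Proof. rewrite /wedge /nrm !rmorphB !rmorphM /=; ring. Qed.

Lemma slope_ray s y x : s \in K -> slope (ray s y) x = s * wedge y x.
Proof.
move=> /fixfP sK; rewrite /slope /ray /wedge /= /nrm !rmorphB !rmorphM /= barK sK; ring.
Qed.

Lemma wedge_fixf x y : wedge x y \in K. Proof. exact: nrm_fixf. Qed.

Lemma wedge_eq0 x y : (wedge x y == 0) = (x.1 * y.2 == x.2 * y.1).
Proof. by rewrite /wedge nrm_eq0 subr_eq0. Qed.

Lemma slope_fixf v x : herm2 v -> slope v x \in K.
Proof.
case/andP=> /fixfP aK /fixfP bK; apply/fixfP.
rewrite /slope /nrm !(rmorphB, rmorphD, rmorphM) /= !barK aK bK; ring.
Qed.

Lemma det2_fixf v : herm2 v -> det2 v \in K.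
Proof.
case/andP=> /fixfP aK /fixfP bK; apply/fixfP.
by rewrite /det2 rmorphB /= bar_nrm rmorphM /= aK bK.
Qed.

Lemma herm2D u v : herm2 u -> herm2 v -> herm2 (u + v).
Proof. by case/andP=> ? ? /andP[? ?]; rewrite /herm2 /= !fixfD. Qed.

Lemma herm2N u : herm2 u -> herm2 (- u).
Proof. by case/andP=> ? ?; rewrite /herm2 /= !fixfN. Qed.

Lemma herm2_ray s x : s \in K -> herm2 (ray s x).
Proof. by move=> sK; apply/andP; split; apply: fixfM => //; apply: nrm_fixf. Qed.

Lemma rayD s t x : ray (s + t) x = ray s x + ray t x.
Proof. by rewrite /ray !mulrDl. Qed.

Lemma rayN s x : ray (- s) x = - ray s x.
Proof. by rewrite /ray !mulNr. Qed.

Lemma ray0 x : ray 0 x = 0.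
Proof. by rewrite /ray !mul0r. Qed.

Lemma ray_eq0 s x : x != 0 -> (ray s x == 0) = (s == 0).
Proof.
move=> x0; have [->|s0] := eqVneq s 0; first by rewrite ray0 eqxx.
apply/negbTE; apply: contra x0 => /eqP e.
have /eqP := congr1 (fun v : form => v.1.1) e; have /eqP := congr1 (fun v : form => v.2) e.
rewrite /ray /= mulf_eq0 (negPf s0) nrm_eq0 /= => /eqP x2.
rewrite mulf_eq0 (negPf s0) nrm_eq0 /= => /eqP x1.
by rewrite [x]surjective_pairing x1 x2.
Qed.

Lemma wedge_neq0l x y : wedge x y != 0 -> x != 0.
Proof. by apply: contraNneq => ->; rewrite wedge_eq0 /= !mul0r. Qed.

Lemma wedge_neq0r x y : wedge x y != 0 -> y != 0.
Proof. by rewrite wedgeC => /wedge_neq0l. Qed.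

Lemma herm2_singular v : herm2 v -> det2 v = 0 ->
  exists s x, [/\ s \in K, x != 0 & v = ray s x].
Proof.
case: v => [[a g] b] /andP[/= aK bK]; rewrite /det2 /= => /subr0_eq abN.
have [a0|a0] := eqVneq a 0.
  exists b, (0, 1); split=> //; first by rewrite xpair_eqE oner_eq0 andbF.
  move: abN; rewrite a0 mul0r => /esym/eqP; rewrite nrm_eq0 => /eqP->.
  by rewrite /ray /nrm /= !mul0r rmorph1 !mulr0 !mulr1.
exists a, (1, bar g / a); split=> //; first by rewrite xpair_eqE oner_eq0.
move/fixfP: aK => aK; rewrite /ray /= /nrm rmorph1 !mul1r mulr1 fmorph_div /= barK aK.
have -> : b = g * bar g / a by rewrite -[g * bar g]abN mulrC mulKf.
congr (_, _, _); by field.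
Qed.

Definition vtx2 v := herm2 v && (det2 v != 0).
Definition adj2 u w := (u != w) && (det2 (u - w) == 0).

Lemma det2N u : det2 (- u) = det2 u.
Proof. rewrite /det2 /= /nrm rmorphN /=; ring. Qed.

Lemma adj2C u w : adj2 u w = adj2 w u.
Proof. by rewrite /adj2 eq_sym -det2N opprB. Qed.

Lemma adj2_ray v s t x : s \in K -> t \in K -> x != 0 -> s != t ->
  adj2 (v + ray s x) (v + ray t x).
Proof.
move=> sK tK x0 st; rewrite /adj2 -subr_eq0 opprD addrACA subrr add0r -rayN -rayD.
by rewrite ray_eq0 // subr_eq0 st det2_ray ?eqxx ?fixfD ?fixfN.
Qed.

Lemma adj2_ray0 v s x : s \in K -> x != 0 -> s != 0 -> adj2 (v + ray s x) v.
Proof. by move=> sK x0 s0; rewrite -[X in adj2 _ X]addr0 -(ray0 x) adj2_ray ?fixf0. Qed.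

(** Representatives of the q^2 + 1 points of the projective line over F. *)
Definition dir (o : option F) : vec := if o is Some t then (1, t) else (0, 1).

Lemma dir_inj_collinear x o o' : x != 0 -> wedge x (dir o) = 0 -> wedge x (dir o') = 0 -> o = o'.
Proof.
case: x => x1 x2 x0 /eqP + /eqP; rewrite !wedge_eq0.
have x10 : x1 = 0 -> x2 != 0.
  by move=> e; apply: contra x0 => /eqP ->; rewrite e.
case: o o' => [t|] [t'|] //=; rewrite ?mulr1 ?mulr0 => /eqP e /eqP e'.
- congr Some; apply: (@mulfI _ x1); last by rewrite e e'.
  by apply/eqP => h; move: (x10 h); rewrite -e h mul0r eqxx.
- by move: (x10 e'); rewrite -e e' mul0r eqxx.
- by move: (x10 e); rewrite -e' e mul0r eqxx.
Qed.

Lemma wedge0_collinear x y : x != 0 -> wedge x y = 0 ->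
  exists c, y = (c * x.1, c * x.2).
Proof.
case: x y => x1 x2 [y1 y2] x0 /eqP; rewrite wedge_eq0 /= => /eqP e.
have [x10|x10] := eqVneq x1 0.
  have x20 : x2 != 0 by apply: contra x0 => /eqP->; rewrite x10.
  exists (y2 / x2); rewrite divfK // x10 mulr0; congr (_, _); apply: (mulfI x20).
  by rewrite -e x10 mul0r mulr0.
by exists (y1 / x1); rewrite divfK // mulrAC [y1 * x2]mulrC -e mulrC mulKf.
Qed.

Lemma slope_scale v c x : slope v (c * x.1, c * x.2) = N c * slope v x.
Proof. rewrite /slope /nrm /= !rmorphM; ring. Qed.

(** The isotropic points of a nonsingular hermitian form on the projective line: at
  least q + 1, found as a fibre of the norm, or as a fibre of the trace together
  with the point at infinity. *)
Lemma isotropic_count v : vtx2 v -> (q.+1 <= #|[set o | slope v (dir o) == 0]%R|)%N.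
Proof.
case: v => [[a g] b] /andP[/andP[/= aK bK]]; rewrite /det2 /= => d0.
have slopeS t : slope (a, g, b) (dir (Some t)) = b - (g * t + bar (g * t)) + a * N t.
  by rewrite /slope /= /nrm !rmorphM rmorph1 /=; ring.
have slopeO : slope (a, g, b) (dir None) = a.
  by rewrite /slope /= /nrm !(rmorph0, rmorph1); ring.
have cardS (A : {set F}) : (forall t, t \in A -> slope (a, g, b) (dir (Some t)) = 0) ->
    (#|A| + (a == 0%R) <= #|[set o | slope (a, g, b) (dir o) == 0]%R|)%N.
  move=> HA; rewrite [X in (_ <= X)%N](cardsD1 None) inE slopeO addnC leq_add2l.
  have injS : injective (@Some F) by move=> ? ? [].
  rewrite -(card_imset A injS); apply/subset_leq_card/subsetP => o /imsetP[t tA ->].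
  by rewrite !inE /= HA.
have [a0|a0] := eqVneq a 0.
  have g0 : g != 0 by apply: contra d0 => /eqP->; rewrite a0 mul0r /nrm mul0r subr0.
  have := cardS [set t / g | t in [set x | x + bar x == b]].
  rewrite a0 eqxx addn1 card_imset; last by apply: mulIf; rewrite invr_eq0.
  rewrite (card_tr bK); apply=> t /imsetP[x].
  rewrite inE => /eqP xb ->; rewrite -a0 slopeS mulrC divfK // xb a0; ring.
pose c := (N g - a * b).
have cK : c \in K by rewrite fixfD ?fixfN ?(fixfM aK bK) ?nrm_fixf.
have c0 : c != 0 by rewrite -oppr_eq0 opprB.
have := cardS [set (x + bar g) / a | x in [set x | N x == c]].
rewrite (negPf a0) addn0 card_imset.
  rewrite (card_nrm cK c0); apply=> t /imsetP[x].
  rewrite inE => /eqP xc ->; rewrite slopeS.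
  move/fixfP: aK => aK.
  rewrite /nrm !(rmorphM, rmorphD, fmorphV) /= !barK aK.
  have -> : b = (g * bar g - x * bar x) / a.
    by rewrite -[x * bar x]/(N x) xc /c /nrm opprB addrC subrK mulrC mulKf.
  by field.
by move=> x x' /(mulIf _) h; apply: (addIr (bar g)); apply: h; rewrite invr_eq0.
Qed.

Lemma second_isotropic v x : vtx2 v -> x != 0 ->
  exists2 y, slope v y = 0 & wedge x y != 0.
Proof.
move=> /isotropic_count; set S := [set o | _] => cS x0.
have /card_gt1P[o [o' [oS o'S oo']]] : (1 < #|S|)%N by lia.
rewrite !inE in oS o'S.
have [e|ne] := eqVneq (wedge x (dir o)) 0; last by exists (dir o) => //; apply/eqP.
exists (dir o'); first exact/eqP.
by apply: contra oo' => /eqP e'; apply/eqP/(dir_inj_collinear x0).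
Qed.

Lemma anisotropic v x : vtx2 v -> x != 0 ->
  exists2 y, slope v y != 0 & wedge x y != 0.
Proof.
case: v => [[a g] b] /andP[_ d0] x0.
pose S1 := [set t | slope (a, g, b) (dir (Some t)) == 0].
pose S2 := [set t | wedge x (dir (Some t)) == 0].
have S1q : (#|S1| <= q.+1)%N.
  have := @card_bar_roots b (- g) (- bar g) a.
  rewrite oppr_eq0; case: (eqVneq b 0) => [b0|_] /=; last first.
    move=> /(_ isT); apply: leq_trans; apply/subset_leq_card/subsetP => t.
    by rewrite !inE /slope /nrm /= rmorph1 => /eqP <-; apply/eqP; ring.
  have -> : g != 0.
    by apply: contra d0 => /eqP->; rewrite /det2 b0 /= /nrm !mul0r mulr0 subr0.
  move=> /(_ isT); apply: leq_trans; apply/subset_leq_card/subsetP => t.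
  by rewrite !inE /slope /nrm /= rmorph1 => /eqP <-; apply/eqP; ring.
have S2q : (#|S2| <= 1)%N.
  rewrite leqNgt; apply/negP => /card_gt1P[s [t []]]; rewrite !inE => /eqP hs /eqP ht /eqP.
  by apply; case: (dir_inj_collinear x0 hs ht).
have /card_gt0P[t] : (0 < #|~: (S1 :|: S2)|)%N.
  rewrite -(ltn_add2l #|S1 :|: S2|) addn0 cardsC cardF.
  apply: leq_ltn_trans (leq_of_leqif (leq_card_setU _ _)) _.
  apply: leq_ltn_trans (leq_add S1q S2q) _; nia.
by rewrite !inE => /norP[h1 h2]; exists (dir (Some t)).
Qed.

(** An induction principle that says that the nonsingular forms of a given
  determinant are connected by steps along isotropic lines; three steps suffice.
  The first step makes a direction x isotropic that is not isotropic for the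
  target w; moving along x then reaches a point adjacent or equal to w, because
  det (_ - w) is not constant in this direction. *)
Lemma isotropic_ind2 (P : form -> Prop) :
  (forall v s x, vtx2 v -> P v -> s \in K -> x != 0 -> vtx2 (v + ray s x) ->
     det2 (v + ray s x) = det2 v -> P (v + ray s x)) ->
  forall u w, vtx2 u -> vtx2 w -> det2 u = det2 w -> P u -> P w.
Proof.
move=> step u w vu vw duw Pu.
have e0 : ((1, 0) : vec) != 0 by rewrite xpair_eqE oner_eq0.
have [x1 ux1 /wedge_neq0r x10] := second_isotropic vu e0.
have [x wx x1x] := anisotropic vw x10; have x0 := wedge_neq0r x1x.
have [hu du0] := andP vu; have [hw _] := andP vw.
pose s := - slope u x / wedge x1 x.
have sK : s \in K.
  by apply: fixfM; [apply/fixfN/slope_fixf|apply/fixfV/wedge_fixf].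
pose u1 := u + ray s x1.
have d1 : det2 u1 = det2 u by rewrite det2_addray // ux1 mulr0 addr0.
have h1 : herm2 u1 by rewrite herm2D ?herm2_ray.
have v1 : vtx2 u1 by rewrite /vtx2 h1 d1.
have b1 : slope u1 x = 0 by rewrite slopeD slope_ray // /s; field.
pose t := det2 (u1 - w) / slope w x.
have tK : t \in K.
  by apply: fixfM; [apply/det2_fixf/herm2D => //; apply: herm2N|apply/fixfV/slope_fixf].
pose u2 := u1 + ray t x.
have d2 : det2 u2 = det2 u1 by rewrite det2_addray // b1 mulr0 addr0.
have h2 : herm2 u2 by rewrite herm2D ?herm2_ray.
have v2 : vtx2 u2 by rewrite /vtx2 h2 d2 d1.
have [||r [y [rK y0 e]]] := @herm2_singular (w - u2).
- by rewrite herm2D ?herm2N.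
- rewrite -opprB det2N (_ : u2 - w = u1 - w + ray t x); last by rewrite /u2; ring.
  by rewrite det2_addray // slopeD slopeN b1 /t; field.
have -> : w = u2 + ray r y by rewrite -e; ring.
have Pu1 : P u1 by apply: step.
have Pu2 : P u2 by apply: step.
have dw : u2 + ray r y = w by rewrite -e; ring.
by apply: step; rewrite ?dw // d2 d1.
Qed.

Lemma vtx2_addray v s x : vtx2 v -> s \in K -> det2 v + s * slope v x != 0 ->
  vtx2 (v + ray s x).
Proof.
case/andP=> hv _ sK d; rewrite /vtx2 det2_addray // d andbT.
by rewrite herm2D // herm2_ray.
Qed.

Lemma vtx2_isoray v s x : vtx2 v -> s \in K -> slope v x = 0 -> vtx2 (v + ray s x).
Proof.
by move=> vv sK b0; apply: vtx2_addray => //; rewrite b0 mulr0 addr0; case/andP: vv.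
Qed.

Lemma slope_addray v s y x : s \in K -> slope (v + ray s y) x = slope v x + s * wedge y x.
Proof. by move=> sK; rewrite slopeD slope_ray. Qed.

Lemma det2_rays2 a b x y : a \in K -> b \in K ->
  det2 (ray a x + ray b y) = a * b * wedge x y.
Proof. by move=> aK bK; rewrite det2_addray // det2_ray // slope_ray //; ring. Qed.

Lemma det2_rays3 a b s x y z : a \in K -> b \in K -> s \in K ->
  det2 (ray a x + ray b y + ray s z) =
    a * b * wedge x y + a * s * wedge x z + b * s * wedge y z.
Proof.
by move=> aK bK sK; rewrite det2_addray // det2_rays2 // slope_addray // slope_ray //; ring.
Qed.

(** * Two isotropic lines with the same image force a collapse *)

Section Collapse.

(** L plays the role of a maximal clique of the target graph of f; Lmax says that a
  vertex adjacent to two of its points belongs to it. *)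

Variables (T : finType) (e : rel T) (L : {set T}) (f : form -> T).
Hypothesis e_irr : irreflexive e.
Hypothesis Lmax : forall l m (t : T), l \in L -> m \in L -> l != m -> e t l -> e t m -> t \in L.
Hypothesis f_hom : forall u w, vtx2 u -> vtx2 w -> adj2 u w -> e (f u) (f w).

Lemma hom_adj_neq u w : vtx2 u -> vtx2 w -> adj2 u w -> f u != f w.
Proof.
by move=> vu vw /(f_hom vu vw); apply: contraTneq => ->; rewrite e_irr.
Qed.

(** The closure property of the preimage of L that drives the whole section. *)
Lemma common_nbr_in u w (t : form) : vtx2 u -> vtx2 w -> vtx2 t -> f u \in L -> f w \in L ->
  f u != f w -> adj2 t u -> adj2 t w -> f t \in L.
Proof.
by move=> vu vw vt uL wL uw tu tw; apply: (Lmax uL wL uw); apply: f_hom.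
Qed.

Definition maps_line v x := forall t, t \in K -> vtx2 (v + ray t x) -> f (v + ray t x) \in L.

Lemma maps_lineI v s x : vtx2 v -> f v \in L -> x != 0 -> s \in K -> s != 0 ->
  vtx2 (v + ray s x) -> f (v + ray s x) \in L -> maps_line v x.
Proof.
move=> vv vL x0 sK s0 vs sL t tK vt.
have [->|t0] := eqVneq t 0; first by rewrite ray0 addr0.
have [->//|ts] := eqVneq t s.
apply: (common_nbr_in vv vs) => //; first by rewrite eq_sym hom_adj_neq // adj2_ray0.
  exact: adj2_ray0.
exact: adj2_ray.
Qed.

Lemma maps_line_shift v s x : s \in K -> maps_line v x -> maps_line (v + ray s x) x.
Proof. by move=> sK vx t tK; rewrite -addrA -rayD; apply: vx; apply: fixfD. Qed.

Lemma maps_line_base v x : vtx2 v -> maps_line v x -> f v \in L.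
Proof.
by move=> vv /(_ 0 fixf0); rewrite ray0 addr0; apply.
Qed.

Lemma hom_line_inj v x s t c : x != 0 -> s \in K -> t \in K ->
  vtx2 (v + ray s x) -> vtx2 (v + ray t x) ->
  f (v + ray s x) = c -> f (v + ray t x) = c -> s = t.
Proof.
move=> x0 sK tK vs vt <- /eqP; apply: contraTeq => st.
by rewrite eq_sym; apply: hom_adj_neq => //; apply: adj2_ray.
Qed.

(** Walk from v to B = v + a[x].  For a suitable b the point C = v + b[y] has another
  image than B and a neighbour on the isotropic line of B in direction y'.  This
  neighbour is a common neighbour of B and C. *)
Lemma turn_line v x y a y' : vtx2 v -> slope v x = 0 -> slope v y = 0 -> wedge x y != 0 ->
  maps_line v x -> maps_line v y -> a \in K -> a != 0 ->
  slope (v + ray a x) y' = 0 -> wedge x y' != 0 -> maps_line (v + ray a x) y'.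
Proof.
move=> vv vx vy xy Lx Ly aK a0 By' xy'; set B := v + ray a x in By' *.
have x0 := wedge_neq0l xy; have y0 := wedge_neq0r xy; have y'0 := wedge_neq0r xy'.
have vB : vtx2 B by apply: vtx2_isoray.
have BL : f B \in L by apply: Lx.
have [b [bK b0 nP nQ]] : exists b, [/\ b \in K, b != 0,
    a * wedge x y' != b * wedge y y' & f (v + ray b y) != f B].
  have [|| b [? ? ? ?]] := @fixf_avoid (fun b => a * wedge x y' == b * wedge y y')
    (fun b => f (v + ray b y) == f B); last by exists b.
    move=> s t _ _ /eqP es /eqP et; apply: (@mulIf _ (wedge y y')); last by rewrite -es -et.
    by apply/eqP => h; move/eqP: es; rewrite h mulr0 mulf_eq0 (negPf a0) (negPf xy').
  by move=> s t sK tK /eqP es /eqP et; apply: hom_line_inj es et => //; apply: vtx2_isoray.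
set C := v + ray b y.
have vC : vtx2 C by apply: vtx2_isoray.
have d0 : a * wedge x y' - b * wedge y y' != 0 by rewrite subr_eq0.
(* The parameter of the point of the line of B that is adjacent to C. *)
pose s := a * b * wedge x y / (a * wedge x y' - b * wedge y y').
have sK : s \in K.
  rewrite /s; apply: fixfM; first by apply: fixfM; [apply: fixfM|apply: wedge_fixf].
  by apply/fixfV/fixfD; [|apply: fixfN]; apply: fixfM => //; apply: wedge_fixf.
have s0 : s != 0.
  by apply: mulf_neq0; rewrite ?invr_eq0 //; apply: mulf_neq0 => //; apply: mulf_neq0.
have vt : vtx2 (B + ray s y') by apply: vtx2_isoray.
have tB : adj2 (B + ray s y') B by apply: adj2_ray0.
apply: (maps_lineI vB BL y'0 sK s0 vt).
apply: (common_nbr_in vB vC) => //; [exact: Ly | by rewrite eq_sym|].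
apply/andP; split; last first.
  have -> : B + ray s y' - C = ray a x + ray s y' + ray (- b) y.
    by rewrite /B /C rayN; ring.
  rewrite det2_rays3 ?fixfN // (wedgeC y' y) /s; apply/eqP; field; exact: d0.
apply/eqP => h; have : det2 (C - B) = - (a * b * wedge x y).
  have -> : C - B = ray b y + ray (- a) x by rewrite rayN /B /C; ring.
  by rewrite det2_rays2 ?fixfN // wedgeC; ring.
rewrite -h addrAC subrr add0r det2_ray // => /esym/eqP.
by apply/negP; rewrite oppr_eq0; apply: mulf_neq0 => //; apply: mulf_neq0.
Qed.

Definition maps_star v := forall z, z != 0 -> maps_line v z.

(** If z is not isotropic at v, the parallelogram v, v + a[x], v + a[x] + s[z],
  v + s[z] does it, where a is chosen to make z isotropic at v + a[x].  If z is
  isotropic, B = v + [x] has another isotropic line than that of x, and a point of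
  it that is mapped differently from v has a neighbour on the line of v in
  direction z. *)
Lemma maps_star_of_two_lines v x y : vtx2 v -> slope v x = 0 -> slope v y = 0 -> wedge x y != 0 ->
  maps_line v x -> maps_line v y -> maps_star v.
Proof.
move=> vv vx vy xy Lx Ly z z0.
have x0 := wedge_neq0l xy.
have vL := maps_line_base vv Lx.
have turn a y' := @turn_line v x y a y' vv vx vy xy Lx Ly.
have [vz|vz] := eqVneq (slope v z) 0; last first.
  have xz : wedge x z != 0.
    apply: contra vz => /eqP xz.
    have [c ->] := wedge0_collinear x0 xz.
    by rewrite slope_scale vx mulr0.
  pose a := - slope v z / wedge x z.
  have aK : a \in K.
    by apply: fixfM; [apply/fixfN/slope_fixf|apply/fixfV/wedge_fixf] => //; case/andP: vv.
  have a0 : a != 0 by apply: mulf_neq0; rewrite ?invr_eq0 ?oppr_eq0.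
  have Bz : slope (v + ray a x) z = 0.
    by rewrite slope_addray // /a; field.
  have LB := turn a z aK a0 Bz xz.
  have vB : vtx2 (v + ray a x) by apply: vtx2_isoray.
  have [|| s [sK s0 nP nQ]] := @fixf_avoid (fun s => det2 v + s * slope v z == 0)
     (fun s => f (v + ray a x + ray s z) == f v).
  - move=> s t _ _ /eqP es /eqP et; apply: (mulIf vz).
    by apply: (addrI (det2 v)); rewrite es et.
  - move=> s t sK tK /eqP es /eqP et.
    by apply: hom_line_inj es et => //; apply: vtx2_isoray.
  have vs : vtx2 (v + ray s z) by apply: vtx2_addray.
  have vw : vtx2 (v + ray a x + ray s z) by apply: vtx2_isoray.
  apply: (maps_lineI vv vL z0 sK s0 vs).
  apply: (common_nbr_in vw vv vs) => //; [exact: LB| |exact: adj2_ray0].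
  rewrite adj2C // (_ : v + _ + _ = (v + ray s z) + ray a x); last by ring.
  exact: adj2_ray0.
have [y' By' xy'] := second_isotropic (vtx2_isoray vv fixf1 vx) x0.
have LB := turn 1 y' fixf1 (oner_neq0 _) By' xy'.
set B := v + ray 1 x in By' LB.
have vB : vtx2 B by apply: vtx2_isoray; rewrite ?fixf1.
have xzy' : (wedge x z != 0) || (wedge y' z != 0).
  rewrite -negb_and; apply: contra xy' => /andP[/eqP xz /eqP y'z].
  have [c ->] := wedge0_collinear z0 (etrans (wedgeC z x) xz).
  have [c' ->] := wedge0_collinear z0 (etrans (wedgeC z y') y'z).
  by rewrite wedge_eq0 /=; apply/eqP; ring.
have [|| s [sK s0 nP nQ]] := @fixf_avoid (fun s => wedge x z + s * wedge y' z == 0)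
     (fun s => f (B + ray s y') == f v).
- move=> s t _ _ /eqP es /eqP et; have h : wedge y' z != 0.
    by move: xzy'; rewrite orbC; case: eqP => //= h; rewrite -es h mulr0 addr0 eqxx.
  by apply: (mulIf h); apply: (addrI (wedge x z)); rewrite es et.
- move=> s t sK tK /eqP es /eqP et.
  by apply: hom_line_inj es et; rewrite ?(wedge_neq0r xy') //; apply: vtx2_isoray.
(* The parameter of the point of the line of v that is adjacent to B + s[y']. *)
pose t := s * wedge x y' / (wedge x z + s * wedge y' z).
have tK : t \in K.
  apply: fixfM; first by apply: fixfM => //; apply: wedge_fixf.
  by apply/fixfV/fixfD; [|apply: fixfM => //]; apply: wedge_fixf.
have t0 : t != 0.
  by apply: mulf_neq0; rewrite ?invr_eq0 //; apply: mulf_neq0.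
have vt : vtx2 (v + ray t z) by apply: vtx2_isoray.
have vw : vtx2 (B + ray s y') by apply: vtx2_isoray.
apply: (maps_lineI vv vL z0 tK t0 vt).
apply: (common_nbr_in vw vv vt) => //; [exact: LB| |exact: adj2_ray0].
apply/andP; split; last first.
  have -> : v + ray t z - (B + ray s y') = - (ray 1 x + ray s y' + ray (- t) z).
    by rewrite /B rayN; ring.
  rewrite det2N det2_rays3 ?fixfN ?fixf1 // /t; apply/eqP; field; exact: nP.
apply/eqP => h; have : det2 (B + ray s y' - v) = s * wedge x y'.
  have -> : B + ray s y' - v = ray 1 x + ray s y' by rewrite /B; ring.
  by rewrite det2_rays2 ?fixf1 // mul1r.
rewrite -h addrAC subrr add0r det2_ray // => /esym/eqP.
by apply/negP; apply: mulf_neq0.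
Qed.

(** The parallelogram v, u = v + b[z], u + t[y], v + t[y] shows that all isotropic
  lines of u are mapped into L, and two of them suffice. *)
Lemma maps_star_step v b z : vtx2 v -> maps_star v -> b \in K -> z != 0 ->
  vtx2 (v + ray b z) -> maps_star (v + ray b z).
Proof.
move=> vv fv bK z0 vu; have [->|b0] := eqVneq b 0; first by rewrite ray0 addr0.
set u := v + ray b z in vu *.
have Lz := fv z z0.
have uL : f u \in L by apply: Lz.
have Luz : maps_line u z by apply: maps_line_shift.
have Luy y : slope u y = 0 -> wedge z y != 0 -> maps_line u y.
  move=> uy zy; have y0 := wedge_neq0r zy.
  have vy : slope v y != 0.
    apply: contra zy => /eqP vy; move/eqP: uy; rewrite slope_addray // vy add0r mulf_eq0.
    by rewrite (negPf b0).
  have [|| t [tK t0 nP nQ]] := @fixf_avoid (fun t => det2 v + t * slope v y == 0)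
    (fun t => (det2 v + t * slope v y != 0) && (f (v + ray t y) == f u)).
  - move=> s t _ _ /eqP es /eqP et; apply: (mulIf vy).
    by apply: (addrI (det2 v)); rewrite es et.
  - move=> s t sK tK /andP[vs /eqP es] /andP[vt /eqP et].
    by apply: hom_line_inj es et => //; apply: vtx2_addray.
  rewrite nP /= in nQ.
  have vt : vtx2 (v + ray t y) by apply: vtx2_addray.
  have vw : vtx2 (u + ray t y) by apply: vtx2_isoray.
  apply: (maps_lineI vu uL y0 tK t0 vw).
  apply: (common_nbr_in vt vu vw) => //; [exact: fv| |exact: adj2_ray0].
  by rewrite /u addrAC; apply: adj2_ray0.
have [y1 uy1 zy1] := second_isotropic vu z0; have y10 := wedge_neq0r zy1.
have [uz|uz] := eqVneq (slope u z) 0.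
  by apply: (maps_star_of_two_lines vu uz uy1 zy1) => //; apply: Luy.
have [y2 uy2 y12] := second_isotropic vu y10.
apply: (maps_star_of_two_lines vu uy1 uy2 y12); apply: Luy => //.
apply: contra uz => /eqP zy2; have [c e2] := wedge0_collinear z0 zy2.
move: (wedge_neq0r y12) uy2; rewrite e2 => c0 /eqP; rewrite slope_scale mulf_eq0 nrm_eq0.
by case/orP=> // /eqP c00; move: c0; rewrite c00 !mul0r eqxx.
Qed.

Lemma full_image v : vtx2 v -> maps_star v -> forall u, vtx2 u -> f u \in L.
Proof.
move=> vv fv u vu.
have e0 : ((1, 0) : vec) != 0 by rewrite xpair_eqE oner_eq0.
have [y vy _] := anisotropic vv e0.
have y0 : y != 0.
  by apply: contra vy => /eqP->; rewrite /slope /nrm /=; apply/eqP; ring.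
have [/andP[hv dv] /andP[hu du]] := (vv, vu).
pose s := (det2 u - det2 v) / slope v y.
have sK : s \in K.
  by apply: fixfM; [apply/fixfD/fixfN; apply: det2_fixf|apply/fixfV/slope_fixf].
have d1 : det2 (v + ray s y) = det2 u by rewrite det2_addray // /s; field.
have v1 : vtx2 (v + ray s y) by apply: vtx2_addray => //; rewrite -det2_addray // d1.
have full1 : maps_star (v + ray s y) by apply: maps_star_step.
have fu : maps_star u.
  apply: (isotropic_ind2 _ v1 vu d1 full1) => w t x vw fw tK x0 vwt _.
  exact: maps_star_step.
exact: maps_line_base (fu _ y0).
Qed.

End Collapse.

(** * The 2 x 2 graph has no colouring with q colours *)

(** A linear coordinate on forms which, on the hyperplane slope _ (dir o) = 0, has
  only singular forms in its kernel. *)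
Definition transverse o v : F := if o is Some t then v.1.1 * t - bar v.1.2 else v.1.2.

Lemma transverse_singular o v : slope v (dir o) = 0 -> transverse o v = 0 -> det2 v = 0.
Proof.
case: v => [[a g] b]; rewrite /slope /det2 /nrm; case: o => [t|] /=; last first.
  rewrite !(rmorph0, rmorph1) => h g0; have -> : a = 0 by rewrite -h g0 rmorph0; ring.
  by rewrite g0; ring.
rewrite rmorph1 => h /subr0_eq e; rewrite -e in h *.
have -> : b = g * t by apply/eqP; rewrite -subr_eq0 -h; apply/eqP; ring.
ring.
Qed.

(** The transverse coordinate is injective on a coclique contained in a hyperplane
  whose normal direction is isotropic. *)
Lemma card_layer_le (S : {set form}) o h :
  {in S &, forall u w, u != w -> det2 (u - w) != 0} ->
  (#|[set u in S | slope u (dir o) == h]| <= q ^ 2)%N.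
Proof.
move=> Sdet; rewrite -cardF -cardsT.
rewrite -(@card_in_imset _ _ (transverse o)); first exact/subset_leq_card/subsetT.
move=> u w; rewrite !inE => /andP[uS /eqP uh] /andP[wS /eqP wh] tuw.
apply/eqP; apply: contraT => /(Sdet _ _ uS wS) /eqP[].
apply: (@transverse_singular o); first by rewrite slopeD slopeN uh wh subrr.
move: tuw; rewrite /transverse; case: o {uh wh} => [t|] /= e; last by rewrite e subrr.
by rewrite rmorphB -(subrr (w.1.1 * t - bar w.1.2)) -{1}e; ring.
Qed.

(** Fix t in S.  Each other u in S lies, for at least q + 1 isotropic points of u - t,
  in the same layer as t, and each of the q^2 + 1 layers of t has at most q^2
  points.  This gives |S| <= q^3 - q^2 + q, and in the case of equality all layers
  have exactly q^2 points.  But the layers of one direction partition S, so q^2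
  would divide q^3 - q^2 + q, which is impossible. *)
Lemma coclique_bound (S : {set form}) :
  {in S, forall u, herm2 u} ->
  {in S &, forall u w, u != w -> det2 (u - w) != 0} ->
  (#|S| + q ^ 2 < q ^ 3 + q)%N.
Proof.
move=> Sherm Sdet; rewrite ltnNge; apply/negP => Sbig.
pose layer (t : form) o := [set u in S | slope u (dir o) == slope t (dir o)].
have layers_full (t : form) : t \in S ->
    (#|S| + q ^ 2 = q ^ 3 + q)%N /\ #|layer t None| = (q ^ 2)%N.
  move=> tS.
  have cO : #|{: option F}| = (q ^ 2).+1 by rewrite card_option cardF.
  have sum_ge : ((q ^ 2).+1 + #|S|.-1 * q.+1 <= \sum_o #|layer t o|)%N.
    have -> : (\sum_o #|layer t o| = \sum_(u in S) #|[set o | slope (u - t) (dir o) == 0]%R|)%N.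
      rewrite (eq_bigr (fun o => \sum_(u in S | (slope (u - t) (dir o) == 0)%R) 1)%N).
        rewrite (exchange_big_dep (mem S)) /=; last by move=> ? ? _ /andP[].
        apply: eq_bigr => u uS; rewrite -sum1_card; apply: eq_bigl => o.
        by rewrite inE uS.
      move=> o _; rewrite -sum1_card; apply: eq_bigl => u.
      by rewrite inE slopeD slopeN subr_eq0.
    rewrite (bigD1 t) //= leq_add //.
      rewrite subrr -cO -cardsT; apply/subset_leq_card/subsetP => o _.
      by rewrite inE /slope /nrm /= rmorph0 !mul0r !addr0 subr0 eqxx.
    rewrite (cardsD1 t S) tS /= -sum_nat_const.
    rewrite (eq_bigl (fun u => u \in S :\ t)); last by move=> u; rewrite !inE andbC.
    apply: leq_sum => u; rewrite !inE => /andP[ut uS].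
    apply: isotropic_count; rewrite /vtx2 Sdet // andbT.
    by rewrite herm2D ?herm2N ?Sherm.
  have layer_le o : (#|layer t o| <= q ^ 2)%N by apply: card_layer_le.
  have S0 : (0 < #|S|)%N by apply/card_gt0P; exists t.
  have sum_le : (\sum_o #|layer t o| <= (q ^ 2).+1 * q ^ 2)%N.
    by rewrite -cO -sum_nat_const; apply: leq_sum.
  have sum_le' : (\sum_o #|layer t o| <= #|layer t None| + q ^ 2 * q ^ 2)%N.
    rewrite (bigD1 None) //= leq_add2l.
    have -> : (q ^ 2 * q ^ 2 = \sum_(o : option F | o != None) q ^ 2)%N.
      rewrite sum_nat_const; congr (_ * _)%N.
      apply: succn_inj; rewrite -cO [LHS](cardD1 None); congr _.+1.
      by apply: eq_card => o; rewrite !inE andbT.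
    by apply: leq_sum.
  move: (layer_le None) Sbig sum_ge sum_le sum_le' S0; move: #|S| #|layer t None| (\sum_o _)%N.
  rewrite !expnS expn0 !muln1 => s l B.
  move: q_ge4 => q4 h1 h2 h3 h4 h5 h6; split; nia.
have Seq : (#|S| + q ^ 2 = q ^ 3 + q)%N.
  have /card_gt0P[t tS] : (0 < #|S|)%N by move: Sbig q_ge4; rewrite !expnS expn0; nia.
  by case: (layers_full t tS).
have /dvdnP[m Sm] : (q ^ 2 %| #|S|)%N.
  rewrite (@sum_fibres _ _ S setT (fun u => slope u (dir None))) //.
  apply: dvdn_sum => h _.
  have [->|/set0Pn[t]] := eqVneq [set u in S | slope u (dir None) == h] set0.
    by rewrite cards0 dvdn0.
  rewrite inE => /andP[tS /eqP <-]; by case: (layers_full t tS) => _ ->.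
have e : (q * (m + 1) = q * q + 1)%N.
  have q0 : (0 < q)%N by lia.
  by apply/eqP; rewrite -(eqn_pmul2l q0); move: Seq; rewrite Sm !expnS expn0; nia.
have [mq|mq] := leqP (m + 1) q.
  by move: (leq_mul (leqnn q) mq); rewrite e; lia.
by move: (leq_mul (leqnn q) mq); rewrite e; lia.
Qed.

(** There are q^4 hermitian forms, of which q^3 - q^2 + q are singular. *)
Lemma card_vtx2 : (q * (q ^ 3 + q) <= #|[set v | vtx2 v]| + q * (q ^ 2).+1)%N.
Proof.
pose H : {set form} := setX (setX K setT) K.
have cK := card_fixf.
have cH : #|H| = (q * q ^ 2 * q)%N by rewrite !cardsX cardsT cK cardF.
pose S0 := [set ((0, 0, b) : form) | b in K].
pose S1 := [set ((a.1, a.2, N a.2 / a.1) : form) | a in setX (K :\ 0%R) setT].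
have HS : H \subset [set v | vtx2 v] :|: (S0 :|: S1).
  apply/subsetP => -[[a g] b]; rewrite in_setX in_setX in_setT andbT => /andP[/= aK bK].
  rewrite in_setU inE /vtx2 /herm2 /= aK bK /=.
  have [d0|//] := eqVneq (det2 (a, g, b)) 0; rewrite /det2 /= in d0.
  rewrite /= in_setU; have [a0|a0] := eqVneq a 0.
    apply/orP; left; apply/imsetP; exists b; rewrite // a0.
    move: d0; rewrite a0 mul0r sub0r => /eqP; rewrite oppr_eq0 nrm_eq0 => /eqP->.
    by [].
  apply/orP; right; apply/imsetP; exists (a, g).
    by rewrite in_setX in_setT in_setD1 /= a0 aK.
  by rewrite /= -(subr0_eq d0) mulrC mulKf.
have := leq_trans (subset_leq_card HS) (leq_of_leqif (leq_card_setU _ _)).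
have S01 := leq_of_leqif (leq_card_setU S0 S1).
have c0 : (#|S0| <= q)%N by rewrite -cK leq_imset_card.
have c1 : (#|S1| <= q.-1 * q ^ 2)%N.
  apply: leq_trans (leq_imset_card _ _) _; rewrite cardsX cardsT cardF leq_mul2r.
  move: (cardsD1 0%R K); rewrite fixf0 cK add1n => h.
  by rewrite -ltnS -h prednK ?leqnn ?orbT //; lia.
rewrite cH; move: S01 c0 c1; move: #|S0| #|S1| #|S0 :|: S1| #|[set v | vtx2 v]|.
move: q_ge4; rewrite !expnS expn0 => q4 s0 s1 s01 v; nia.
Qed.

(** Zero differs from each vertex by a nonsingular form, so it can be added to a colour
  class before the bound is applied; without this the count would not exclude an
  equipartition. *)
Lemma no_colouring (T : finType) (L : {set T}) (f : form -> T) :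
  (#|L| <= q)%N -> (forall v, vtx2 v -> f v \in L) ->
  ~ (forall u w, vtx2 u -> vtx2 w -> adj2 u w -> f u != f w).
Proof.
move=> Lq fL fcol.
have class_lt l : l \in L ->
    (#|[set v in [set v | vtx2 v] | f v == l]| <= (q ^ 3 + q - q ^ 2).-2)%N.
  move=> _; set C := [set v in _ | _].
  have vC u : u \in C -> vtx2 u /\ f u = l by rewrite !inE => /andP[? /eqP].
  have := @coclique_bound ((0 : form) |: C).
  rewrite cardsU1 (_ : (0 : form) \notin C); last first.
    apply/negP => /vC[/andP[_ /eqP[]]]; rewrite /det2 /nrm /=; ring.
  move=> h; rewrite -ltnS -ltnS.
  have : (1 + #|C| + q ^ 2 < q ^ 3 + q)%N; last first.
    by move: #|C| => c; rewrite !expnS expn0; nia.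
  apply: h.
    move=> u /setU1P[->|/vC[/andP[] //]]; by rewrite /herm2 !fixf0.
  have det0 u : u \in C -> det2 u != 0 by move=> /vC[/andP[]].
  move=> u w /setU1P[->|uC] /setU1P[->|wC]; rewrite ?eqxx //.
  - by move=> _; rewrite sub0r det2N det0.
  - by move=> _; rewrite subr0 det0.
  move=> uw; have [[vu fu] [vw fw]] := (vC u uC, vC w wC).
  apply/negP => d; move: (fcol u w vu vw); rewrite /adj2 uw d fu fw eqxx.
  by move/(_ isT).
have fL' v : v \in [set v | vtx2 v] -> f v \in L by rewrite inE; apply: fL.
have := card_vtx2; rewrite (sum_fibres fL').
have : (\sum_(l in L) #|[set v in [set v | vtx2 v] | f v == l]| <=
        q * (q ^ 3 + q - q ^ 2).-2)%N.
  apply: (@leq_trans (\sum_(l in L) (q ^ 3 + q - q ^ 2).-2)%N).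
    by apply: leq_sum.
  by rewrite sum_nat_const leq_mul2r Lq orbT.
move: (\sum_(l in L) _)%N => A; move: q_ge4; rewrite !expnS expn0 !muln1 => q4 h1 h2.
have : (q * (q * (q * q) + q) <= q * ((q * (q * q) + q - q * q).-2 + (q * q).+1))%N.
  by rewrite [X in (_ <= X)%N]mulnDr; apply: leq_trans h2 _; rewrite leq_add2r.
have q0 : (0 < q)%N by lia.
rewrite leq_pmul2l //; nia.
Qed.

Section TwoLines.

Variables (T : finType) (e : rel T) (L : {set T}) (f : form -> T).
Hypothesis e_irr : irreflexive e.
Hypothesis Lmax : forall l m (t : T), l \in L -> m \in L -> l != m -> e t l -> e t m -> t \in L.
Hypothesis cardL : (#|L| <= q)%N.
Hypothesis f_hom : forall u w, vtx2 u -> vtx2 w -> adj2 u w -> e (f u) (f w).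

Theorem two_isotropic_lines v x y : vtx2 v -> slope v x = 0 -> slope v y = 0 ->
  wedge x y != 0 -> maps_line L f v x -> ~ maps_line L f v y.
Proof.
move=> vv vx vy xy Lx Ly.
have fv := maps_star_of_two_lines e_irr Lmax f_hom vv vx vy xy Lx Ly.
have fL := full_image e_irr Lmax f_hom vv fv.
apply: (no_colouring cardL fL) => u w vu vw uw.
exact: (hom_adj_neq e_irr f_hom).
Qed.

End TwoLines.

End BinaryForms.

(** * Hermitian n x n matrices *)

Definition star m n (A : 'M[F]_(m, n)) : 'M[F]_(n, m) := (map_mx bar A)^T.

Lemma starK m n : cancel (@star m n) (@star n m).
Proof. by move=> A; apply/matrixP => i j; rewrite !mxE barK. Qed.

Lemma starM m n p (A : 'M_(m, n)) (B : 'M_(n, p)) : star (A *m B) = star B *m star A.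
Proof. by rewrite /star map_mxM trmx_mul. Qed.

Lemma starD m n (A B : 'M_(m, n)) : star (A + B) = star A + star B.
Proof. by rewrite /star map_mxD linearD. Qed.

Lemma starN m n (A : 'M_(m, n)) : star (- A) = - star A.
Proof. by rewrite /star map_mxN linearN. Qed.

Lemma starB m n (A B : 'M_(m, n)) : star (A - B) = star A - star B.
Proof. by rewrite starD starN. Qed.

Lemma starZ m n c (A : 'M_(m, n)) : star (c *: A) = bar c *: star A.
Proof. by rewrite /star map_mxZ linearZ. Qed.

Lemma star0 m n : star (0 : 'M_(m, n)) = 0.
Proof. by rewrite /star map_mx0 trmx0. Qed.

Lemma star1 n : star (1%:M : 'M_n) = 1%:M.
Proof. by rewrite /star map_mx1 trmx1. Qed.

Lemma star_eq0 m n (A : 'M_(m, n)) : (star A == 0) = (A == 0).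
Proof. by rewrite -(can_eq (@starK n m)) starK star0. Qed.

Lemma star_inv n (A : 'M_n) : star (invmx A) = invmx (star A).
Proof. by rewrite /star map_invmx trmx_inv. Qed.

Lemma det_star n (A : 'M_n) : \det (star A) = bar (\det A).
Proof. by rewrite /star det_tr det_map_mx. Qed.

Section Matrices.

Local Notation vec := (F * F)%type.
Local Notation form := (F * F * F)%type.

Variable n : nat.
Implicit Types (A B C D H : 'M[F]_n) (x y z w : 'cV[F]_n) (u v : form).

Definition is_herm A := star A == A.

Lemma is_hermP A : reflect (star A = A) (is_herm A).
Proof. exact: eqP. Qed.

Lemma hermD A B : is_herm A -> is_herm B -> is_herm (A + B).
Proof. by move=> /is_hermP hA /is_hermP hB; apply/is_hermP; rewrite starD hA hB. Qed.

Lemma hermN A : is_herm A -> is_herm (- A).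
Proof. by move=> /is_hermP hA; apply/is_hermP; rewrite starN hA. Qed.

Lemma hermB A B : is_herm A -> is_herm B -> is_herm (A - B).
Proof. by move=> hA hB; apply/hermD/hermN. Qed.

Lemma hermZ c A : c \in K -> is_herm A -> is_herm (c *: A).
Proof. by move=> /fixfP cK /is_hermP hA; apply/is_hermP; rewrite starZ hA cK. Qed.

Lemma hermV A : is_herm A -> is_herm (invmx A).
Proof. by move=> /is_hermP hA; apply/is_hermP; rewrite star_inv hA. Qed.

Definition dyad x : 'M[F]_n := x *m star x.

Lemma herm_dyad x : is_herm (dyad x).
Proof. by apply/is_hermP; rewrite starM starK. Qed.

Lemma dyadZ c x : dyad (c *: x) = N c *: dyad x.
Proof. by rewrite /dyad starZ -scalemxAl -scalemxAr scalerA. Qed.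

Lemma dyad_eq0 x : (dyad x == 0) = (x == 0).
Proof.
apply/eqP/eqP => [s0|->]; last by rewrite /dyad mul0mx.
apply/colP => i; have /eqP := congr1 (fun M : 'M_n => M i i) s0.
by rewrite !mxE big_ord1 !mxE -/(nrm _) nrm_eq0 => /eqP.
Qed.

Lemma mulmx_11r (M : 'M[F]_1) m (A : 'M[F]_(m, 1)) : A *m M = M 0 0 *: A.
Proof. by rewrite [M in LHS]mx11_scalar mul_mx_scalar. Qed.

Lemma mulmx_11l (M : 'M[F]_1) m (A : 'M[F]_(1, m)) : M *m A = M 0 0 *: A.
Proof. by rewrite [M in LHS]mx11_scalar mul_scalar_mx. Qed.

(** A rank-one matrix is a column times a row; hermitian symmetry makes the row
  proportional to the conjugate transpose of the column, with a factor in K. *)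
Lemma herm_rank1 A : is_herm A -> (\rank A <= 1)%N ->
  exists s x, [/\ s \in K, A != 0 -> (s != 0) && (x != 0) & A = s *: dyad x].
Proof.
move=> /is_hermP hA rA; have [A0|A0] := eqVneq A 0.
  by exists 0, 0; rewrite fixf0 scale0r; split.
have [c [r Acr]] := rank1_outer rA.
have c0 : c != 0 by apply: contra A0 => /eqP c0; rewrite Acr c0 mul0mx.
have [i ci0] : exists i, c i 0 != 0.
  apply/existsP; apply: contraNT c0; rewrite negb_exists => /forallP c0.
  by apply/eqP/colP => i; rewrite mxE; apply/eqP; move: (c0 i); rewrite negbK.
pose m := star r i 0 / c i 0.
have rc : r = m *: star c.
  apply: (scalerI ci0); rewrite /m scalerA mulrC divfK //.
  have /(congr1 (row i)) : c *m r = star r *m star c by rewrite -starM -Acr.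
  by rewrite !row_mul !mulmx_11l !mxE.
have Amc : A = m *: dyad c by rewrite Acr rc -scalemxAr.
have m0 : m != 0 by apply: contra A0 => /eqP m0; rewrite Amc m0 scale0r.
exists m, c; split=> //; last by rewrite m0 c0.
apply/fixfP/eqP; rewrite -subr_eq0.
have /eqP := hA; rewrite Amc starZ (is_hermP _ (herm_dyad c)) -subr_eq0 -scalerBl scaler_eq0.
by rewrite dyad_eq0 (negPf c0) orbF.
Qed.

Lemma rank_dyad s x : s != 0 -> x != 0 -> \rank (s *: dyad x) = 1%N.
Proof.
move=> s0 x0; apply/eqP; rewrite eqn_leq lt0n mxrank_eq0 scaler_eq0 dyad_eq0 negb_or s0 x0.
by rewrite (leq_trans (mxrank_scale _ _)) // mulmx_max_rank.
Qed.

(** Test the equation t[y] - s[x] = r[z] on a vector k orthogonal to y but not to x: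
  then z is proportional to x, hence so is [y] to [x], against the choice of k. *)
Lemma rank1_difference_collinear (s t : F) x y : s != 0 -> x != 0 -> y != 0 -> s \in K -> t \in K ->
  (\rank (t *: dyad y - s *: dyad x)%R <= 1)%N -> t != 0 -> exists c, x = c *: y.
Proof.
move=> s0 x0 y0 sK tK rM t0.
have [/sub_rVP[c xcy]|nxy] := boolP (star x <= star y)%MS.
  by exists (bar c); rewrite -[x]starK xcy starZ starK.
have [k xk yk] : exists2 k : 'cV[F]_n, star x *m k != 0 & star y *m k = 0.
  rewrite submxE in nxy.
  have [i xi] : exists i, col i (star x *m cokermx (star y)) != 0.
    apply/existsP; apply: contraNT nxy; rewrite negb_exists => /forallP h.
    apply/eqP/matrixP => j i; have := h i; rewrite negbK => /eqP/colP/(_ j).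
    by rewrite !mxE.
  exists (col i (cokermx (star y))); first by rewrite colE mulmxA -colE.
  by rewrite colE mulmxA mulmx_coker mul0mx.
have hM : is_herm (t *: dyad y - s *: dyad x).
  by apply: hermB; apply: hermZ => //; apply: herm_dyad.
have [r [z [rK _ e]]] := herm_rank1 hM rM.
have e1 := congr1 (mulmx^~ k) e.
have {}xk : (star x *m k) 0 0 != 0.
  by apply: contra xk => /eqP h; rewrite [star x *m k]mx11_scalar h raddf0.
move: e1; rewrite mulmxBl -!scalemxAl -!mulmxA yk mulmx0 scaler0 sub0r !mulmx_11r !scalerA => e1.
set p := s * _ in e1; have p0 : p != 0 by apply: mulf_neq0.
set p' := r * _ in e1.
have xz : x = (- p' / p) *: z.
  by apply: (scalerI p0); rewrite scalerA mulrC divfK // scaleNr -e1 opprK.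
have p'0 : p' != 0 by apply: contra x0 => /eqP h; rewrite xz h oppr0 mul0r scale0r.
pose m := - p / p'.
have zx : z = m *: x.
  by apply: (scalerI p'0); rewrite scalerA mulrC divfK // scaleNr -e1.
move: e; rewrite zx dyadZ scalerA => /(canRL (addrNK _)); rewrite -scalerDl => e.
have := congr1 (mulmx^~ k) e; rewrite -!scalemxAl -!mulmxA yk mulmx0 scaler0 mulmx_11r scalerA.
move=> /esym/eqP; rewrite scaler_eq0 (negPf x0) orbF mulf_eq0 (negPf xk) orbF => /eqP h.
by move/eqP: e; rewrite h scale0r scaler_eq0 (negPf t0) dyad_eq0 (negPf y0).
Qed.

Definition vtx A := is_herm A && (A \in unitmx).
Definition invform A x y : F := (star x *m invmx A *m y) 0 0.

Lemma invform_bar A x y : is_herm A -> bar (invform A x y) = invform A y x.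
Proof.
move=> /is_hermP hA; rewrite /invform; set M := star x *m _ *m y.
have -> : star y *m invmx A *m x = star M.
  by rewrite /M !starM starK star_inv hA mulmxA.
by rewrite /star !mxE.
Qed.

Lemma invform_fixf A x : is_herm A -> invform A x x \in K.
Proof. by move=> hA; apply/fixfP/invform_bar. Qed.

(** The embedding of hermitian 2 x 2 forms as hermitian matrices supported on the
  span of x and y. *)
Definition lift2 x y u : 'M[F]_n :=
  u.1.1 *: dyad x + u.1.2 *: (x *m star y) + bar u.1.2 *: (y *m star x) + u.2 *: dyad y.

Lemma lift2D x y u v : lift2 x y (u + v) = lift2 x y u + lift2 x y v.
Proof. by apply/matrixP => i j; rewrite /lift2 /= rmorphD !mxE; ring. Qed.

Lemma lift2N x y u : lift2 x y (- u) = - lift2 x y u.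
Proof. by rewrite /lift2 /= rmorphN !scaleNr !opprD. Qed.

Lemma lift2_ray x y s (p : vec) : s \in K ->
  lift2 x y (ray s p) = s *: dyad (p.1 *: x + p.2 *: y).
Proof.
move=> /fixfP sK; apply/matrixP => i j; rewrite /lift2 /ray /dyad /star /=.
rewrite !rmorphM /= barK sK !mxE !big_ord1 !mxE !rmorphD !rmorphM /nrm; ring.
Qed.

Lemma herm_lift2 x y u : herm2 u -> is_herm (lift2 x y u).
Proof.
case/andP=> /fixfP aK /fixfP bK; apply/is_hermP.
rewrite /lift2 !starD !starZ !starM !starK barK aK bK.
by rewrite -!addrA; congr (_ + _); rewrite addrCA.
Qed.

(** By Sylvester's identity the determinant reduces to that of a 2 x 2 matrix. *)
Lemma det_lift2 A x y u : A \in unitmx ->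
  \det (A + lift2 x y u) = \det A *
    (1 + u.1.1 * invform A x x + u.1.2 * invform A y x + bar u.1.2 * invform A x y
       + u.2 * invform A y y
       + det2 u * (invform A x x * invform A y y - invform A x y * invform A y x)).
Proof.
move=> uA; pose X := row_mx x y; pose Y := col_mx (star x) (star y).
pose D : 'M[F]_(1 + 1) := block_mx u.1.1%:M u.1.2%:M (bar u.1.2)%:M u.2%:M.
have -> : A + lift2 x y u = A *m (1%:M + (invmx A *m X) *m (D *m Y)).
  rewrite mulmxDr mulmx1 !mulmxA mulmxV // mul1mx; congr (_ + _).
  rewrite /X /D /Y mul_row_block mul_row_col !mul_mx_scalar /lift2 !mulmxDl -!scalemxAl.
  by rewrite !addrA; congr (_ + _); rewrite addrAC.
rewrite det_mulmx det_1_addC -mulmxA /X /Y mul_mx_row mul_col_row; congr (_ * _).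
rewrite /D mulmx_block !mul_scalar_mx (scalar_mx_block 1 1) add_block_mx det_mx2.
rewrite block_mxKul block_mxKur block_mxKdl block_mxKdr !add0r !mulmxA.
rewrite ![fun_of_matrix (_ + _) _ _]mxE ![fun_of_matrix (_ *: _) _ _]mxE -!/(invform A _ _).
rewrite !mxE eqxx mulr1n /det2 /nrm; ring.
Qed.

Lemma det_add_dyad A s x : A \in unitmx ->
  \det (A + s *: dyad x) = \det A * (1 + s * invform A x x).
Proof.
move=> uA; have -> : A + s *: dyad x = A *m (1%:M + (invmx A *m x) *m (s *: star x)).
  by rewrite mulmxDr mulmx1 !mulmxA mulmxV // mul1mx -scalemxAr.
rewrite det_mulmx det_1_addC -scalemxAl mulmxA det_mx11; congr (_ * _).
by rewrite mxE [X in _ + X]mxE mxE eqxx.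
Qed.

(** The Gram determinant of x and y for the form of A^-1, and the inverse of their
  Gram matrix.  Shifting by this inverse identifies the matrices A + lift2 x y _
  with the 2 x 2 forms, up to a constant factor of the determinant. *)
Definition gram A x y := invform A x x * invform A y y - invform A x y * invform A y x.
Definition gram_inv A x y : form :=
  (invform A y y / gram A x y, - invform A x y / gram A x y, invform A x x / gram A x y).

Lemma gram_fixf A x y : is_herm A -> gram A x y \in K.
Proof.
move=> hA; apply/fixfP; rewrite /gram rmorphB !rmorphM /= !invform_bar //.
by rewrite [invform A y x * _]mulrC.
Qed.

Lemma gram_inv_herm A x y : is_herm A -> herm2 (gram_inv A x y).
Proof.
move=> hA; have gK := fixfV (gram_fixf x y hA).
by rewrite /herm2 /= !fixfM ?invform_fixf.
Qed.

Lemma det_pencil A x y u : vtx A -> gram A x y != 0 ->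
  \det (A + lift2 x y (u - gram_inv A x y)) = \det A * gram A x y * det2 u.
Proof.
case/andP=> hA uA g0; rewrite det_lift2 // -/(gram A x y) -mulrA; congr (_ * _).
have /fixfP gK := gram_fixf x y hA.
rewrite /det2 /nrm /= !rmorphB !rmorphM fmorphV rmorphN gK invform_bar //.
set gxx := invform A x x; set gyy := invform A y y.
set gxy := invform A x y; set gyx := invform A y x.
move: g0; rewrite /gram -/gxx -/gyy -/gxy -/gyx => g0; field; exact: g0.
Qed.

Lemma lift2_e1 x y s : s \in K -> lift2 x y (ray s (1, 0)) = s *: dyad x.
Proof. by move=> sK; rewrite lift2_ray //= scale1r scale0r addr0. Qed.

Lemma lift2_e2 x y s : s \in K -> lift2 x y (ray s (0, 1)) = s *: dyad y.
Proof. by move=> sK; rewrite lift2_ray //= scale1r scale0r add0r. Qed.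

(** * Generic vectors *)

Definition hval (H : 'M[F]_n) w : F := (star w *m H *m w) 0 0.

Lemma sesqui_bar H x y : is_herm H -> (star y *m H *m x) 0 0 = bar ((star x *m H *m y) 0 0).
Proof.
move=> /is_hermP hH; set M := star x *m H *m y.
have -> : star y *m H *m x = star M by rewrite /M !starM starK hH mulmxA.
by rewrite /star !mxE.
Qed.

Lemma hvalD H w z t : is_herm H -> hval H (w + t *: z) =
  hval H w + (star w *m H *m z) 0 0 * t + bar ((star w *m H *m z) 0 0) * bar t
    + hval H z * (t * bar t).
Proof.
move=> hH; rewrite /hval -(sesqui_bar _ _ hH) starD starZ !mulmxDl !mulmxDr.
rewrite -!scalemxAl -!scalemxAr.
do !rewrite [fun_of_matrix (_ + _) _ _]mxE.
rewrite ![fun_of_matrix (_ *: _) _ _]mxE; ring.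
Qed.

Lemma sesqui_delta (H : 'M[F]_n) i j :
  (star (delta_mx i 0 : 'cV[F]_n) *m H *m (delta_mx j 0 : 'cV[F]_n)) 0 0 = H i j.
Proof.
have -> : star (delta_mx i 0 : 'cV[F]_n) = delta_mx 0 i.
  by rewrite /star map_delta_mx trmx_delta.
by rewrite -rowE -colE !mxE.
Qed.

(** If all the diagonal entries involved vanish, polarize and use that the trace is
  onto; this works in characteristic 2 as well. *)
Lemma hval_neq0 H : is_herm H -> H != 0 -> exists w, hval H w != 0.
Proof.
move=> hH /matrix0Pn[i [j Hij]].
have [Hii|] := eqVneq (H i i) 0; last by exists (delta_mx i 0); rewrite /hval sesqui_delta.
have [Hjj|] := eqVneq (H j j) 0; last by exists (delta_mx j 0); rewrite /hval sesqui_delta.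
have [s s1] := trace_surj fixf1.
exists (delta_mx i 0 + (s / H i j) *: delta_mx j 0).
rewrite hvalD // /hval !sesqui_delta Hii Hjj add0r mul0r addr0 -rmorphM mulrC divfK // s1.
exact: oner_neq0.
Qed.

(** On the line w + t z each form vanishes for at most q + 1 values of t, and
  3 (q + 1) < q^2 when q >= 4. *)
Lemma generic_step H1 H2 H3 w z : is_herm H1 -> is_herm H2 -> is_herm H3 ->
  hval H1 w != 0 -> hval H2 w != 0 -> hval H3 z != 0 ->
  exists v : 'cV_n, [/\ hval H1 v != 0, hval H2 v != 0 & hval H3 v != 0].
Proof.
move=> h1 h2 h3 w1 w2 z3.
pose S H := [set t | hval H (w + t *: z) == 0].
have S_le H : is_herm H -> (hval H w != 0) || (hval H z != 0) -> (#|S H| <= q.+1)%N.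
  move=> hH nz.
  have := @card_bar_roots (hval H w)
    ((star w *m H *m z) 0 0) (bar ((star w *m H *m z) 0 0)) (hval H z).
  case/orP: nz => nz; rewrite nz ?orbT /= => /(_ isT); apply: leq_trans;
  by apply/subset_leq_card/subsetP => t; rewrite !inE hvalD.
have /card_gt0P[t] : (0 < #|~: (S H1 :|: S H2 :|: S H3)|)%N.
  rewrite -(ltn_add2l #|S H1 :|: S H2 :|: S H3|) addn0 cardsC cardF.
  apply: leq_ltn_trans (leq_of_leqif (leq_card_setU _ _)) _.
  apply: leq_ltn_trans (leq_add (leq_of_leqif (leq_card_setU _ _)) (leqnn _)) _.
  apply: leq_ltn_trans (leq_add (leq_add (S_le H1 h1 _) (S_le H2 h2 _)) (S_le H3 h3 _)) _.
  - by rewrite w1.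
  - by rewrite w2.
  - by rewrite z3 orbT.
  - nia.
by rewrite !inE !negb_or -andbA => /and3P[? ? ?]; exists (w + t *: z).
Qed.

Lemma generic_vector H1 H2 H3 : is_herm H1 -> is_herm H2 -> is_herm H3 ->
  H1 != 0 -> H2 != 0 -> H3 != 0 ->
  exists v : 'cV_n, [/\ hval H1 v != 0, hval H2 v != 0 & hval H3 v != 0].
Proof.
move=> h1 h2 h3 n1 n2 n3.
have [[w1 v1] [w2 v2] [w3 v3]] := And3 (hval_neq0 h1 n1) (hval_neq0 h2 n2) (hval_neq0 h3 n3).
have [w [w_1 _ w_2]] := generic_step h1 h1 h2 v1 v1 v2.
exact: generic_step w_1 w_2 v3.
Qed.

(** * Vertices of equal determinant are connected *)

Hypothesis n_ge2 : (2 <= n)%N.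

Definition iso_adj : rel 'M[F]_n := fun A B =>
  [&& vtx A, vtx B, \rank (A - B) == 1%N & \det A == \det B].
Definition iso_conn := connect iso_adj.

Lemma iso_conn_sym A B : iso_conn A B = iso_conn B A.
Proof.
apply: sym_connect_sym => {}A {}B; rewrite /iso_adj -mxrank_opp opprB [\det A == _]eq_sym.
by rewrite andbCA.
Qed.

Lemma vtxP A : is_herm A -> \det A != 0 -> vtx A.
Proof. by move=> hA d; rewrite /vtx hA unitmxE unitfE. Qed.

Lemma vtx_det A : vtx A -> \det A != 0.
Proof. by case/andP=> _; rewrite unitmxE unitfE. Qed.

Lemma vtx_herm A : vtx A -> is_herm A. Proof. by case/andP. Qed.
Lemma vtx_unit A : vtx A -> A \in unitmx. Proof. by case/andP. Qed.

Lemma herm_add_dyad A s x : is_herm A -> s \in K -> is_herm (A + s *: dyad x).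
Proof. by move=> hA sK; apply: hermD => //; apply: hermZ => //; apply: herm_dyad. Qed.

Lemma iso_conn_add_dyad A s x : vtx A -> vtx (A + s *: dyad x) ->
  \det (A + s *: dyad x) = \det A -> iso_conn A (A + s *: dyad x).
Proof.
move=> vA vB dB; have [->|s0] := eqVneq s 0; first by rewrite scale0r addr0 /iso_conn connect0.
have [->|x0] := eqVneq x 0; first by rewrite /dyad mul0mx scaler0 addr0 /iso_conn connect0.
apply: connect1; rewrite /iso_adj vA vB dB eqxx andbT opprD addrA subrr sub0r mxrank_opp.
by rewrite (rank_dyad s0 x0).
Qed.

Lemma iso_conn_pencil A x y u (w : form) : vtx A -> gram A x y != 0 -> herm2 u -> herm2 w ->
  vtx (A + lift2 x y u) -> \det (A + lift2 x y u) = \det (A + lift2 x y w) ->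
  iso_conn (A + lift2 x y u) (A + lift2 x y w).
Proof.
move=> vA g0 hu hw vu duw; have [hA uA] := andP vA.
have hh := gram_inv_herm x y hA; set h := gram_inv A x y in hh.
pose f v := A + lift2 x y (v - h).
have det_f v : \det (f v) = \det A * gram A x y * det2 v by apply: det_pencil.
have c0 : \det A * gram A x y != 0 by rewrite mulf_neq0 // vtx_det.
have vf v : vtx2 v -> vtx (f v).
  case/andP=> hv dv; apply: vtxP; last by rewrite det_f mulf_neq0.
  by apply: hermD => //; apply/herm_lift2/herm2D/herm2N.
have fE v : f (v + h) = A + lift2 x y v by rewrite /f addrK.
rewrite -!fE; apply: (isotropic_ind2 (P := fun v => iso_conn (f (u + h)) (f v))) (u + h) _ _ _ _ _.
- move=> v s p vv cv sK p0 vs ds; apply: connect_trans cv _.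
  have e : f (v + ray s p) = f v + s *: dyad (p.1 *: x + p.2 *: y).
    rewrite /f (_ : v + ray s p - h = v - h + ray s p); last by ring.
    by rewrite lift2D lift2_ray // addrA.
  by rewrite e; apply: iso_conn_add_dyad; rewrite -?e ?det_f ?ds //; apply: vf.
- rewrite /vtx2 herm2D //=; move: (vtx_det vu); rewrite -fE det_f; apply: contraNneq => ->.
  by rewrite mulr0.
- rewrite /vtx2 herm2D //=; move: (vtx_det vu); rewrite duw -fE det_f; apply: contraNneq => ->.
  by rewrite mulr0.
- by apply: (mulfI c0); rewrite -!det_f !fE.
- exact: connect0.
Qed.

(** The matrix of the hermitian form gram A x _. *)
Definition gram_mx A x : 'M[F]_n := invform A x x *: invmx A - invmx A *m dyad x *m invmx A.

Lemma herm_gram_mx A x : is_herm A -> is_herm (gram_mx A x).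
Proof.
move=> hA; apply: hermB; first by apply: hermZ; [apply: invform_fixf|apply: hermV].
by apply/is_hermP; rewrite !starM !starK star_inv (is_hermP _ hA) !mulmxA.
Qed.

Lemma hval_gram_mx A x y : hval (gram_mx A x) y = gram A x y.
Proof.
rewrite /hval /gram_mx mulmxBr mulmxBl -scalemxAr -scalemxAl mxE [in RHS]/gram.
rewrite [fun_of_matrix (_ *: _) _ _]mxE -[(star y *m invmx A *m y) 0 0]/(invform A y y).
congr (_ + _); rewrite mxE [invform A x y * _]mulrC; congr (- _).
have -> : star y *m (invmx A *m dyad x *m invmx A) *m y =
    (star y *m invmx A *m x) *m (star x *m invmx A *m y) by rewrite !mulmxA.
by rewrite mxE big_ord1.
Qed.

Lemma invmx_neq0 A : vtx A -> invmx A != 0.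
Proof.
case/andP=> _ uA; rewrite -mxrank_eq0 mxrank_unit ?unitmx_inv // -lt0n.
exact: ltnW.
Qed.

Lemma gram_mx_neq0 A x : vtx A -> x != 0 -> gram_mx A x != 0.
Proof.
case/andP=> hA uA x0; rewrite /gram_mx subr_eq0; apply/eqP => e.
have uV : invmx A \in unitmx by rewrite unitmx_inv.
have r1 : (\rank (invmx A *m dyad x *m invmx A) <= 1)%N.
  apply: leq_trans (mxrankM_maxl _ _) _; apply: leq_trans (mxrankM_maxr _ _) _.
  exact: mulmx_max_rank.
have [g0|g0] := eqVneq (invform A x x) 0.
  move: e; rewrite g0 scale0r => /(congr1 (fun M => A *m M *m A)).
  rewrite mulmx0 mul0mx !mulmxA mulmxV // mul1mx mulmxKV // => /esym/eqP.
  by rewrite dyad_eq0 (negPf x0).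
move: r1; rewrite -e => r1; have := mxrank_unit uV.
by rewrite -(mxrank_scale_nz _ g0) => r; move: r1; rewrite r; lia.
Qed.

(** Both vertices are connected to a third one, on a line in a generic direction w:
  each of the pairs then lies in a nondegenerate pencil, where the 2 x 2 case
  applies. *)
Lemma iso_conn_star A a x b y : vtx A -> a \in K -> b \in K ->
  vtx (A + a *: dyad x) -> vtx (A + b *: dyad y) ->
  invform A x x != 0 -> invform A y y != 0 ->
  \det (A + a *: dyad x) = \det (A + b *: dyad y) ->
  iso_conn (A + a *: dyad x) (A + b *: dyad y).
Proof.
move=> vA aK bK vx vy gx gy dxy; have [hA uA] := andP vA.
have nz z : invform A z z != 0 -> z != 0.
  by apply: contra => /eqP->; rewrite /invform mulmx0 mxE.
have [w [xw yw ww]] : exists w : 'cV_n, [/\ hval (gram_mx A x) w != 0,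
    hval (gram_mx A y) w != 0 & hval (invmx A) w != 0].
  exact: (generic_vector (herm_gram_mx x hA) (herm_gram_mx y hA) (hermV hA)
    (gram_mx_neq0 vA (nz _ gx)) (gram_mx_neq0 vA (nz _ gy)) (invmx_neq0 vA)).
rewrite !hval_gram_mx in xw yw; rewrite -/(invform A w w) in ww.
pose c := a * invform A x x / invform A w w.
have cK : c \in K by rewrite !(fixfM, fixfV) ?invform_fixf.
have dc : \det (A + c *: dyad w) = \det (A + a *: dyad x).
  by rewrite !det_add_dyad // /c divfK.
have half z e : e \in K -> vtx (A + e *: dyad z) -> gram A z w != 0 ->
    \det (A + e *: dyad z) = \det (A + c *: dyad w) -> iso_conn (A + e *: dyad z) (A + c *: dyad w).
  move=> eK vz gz dz.
  rewrite -(lift2_e1 z w eK) -(lift2_e2 z w cK).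
  by apply: iso_conn_pencil; rewrite ?herm2_ray ?lift2_e1 ?lift2_e2.
apply: connect_trans (half x a aK vx xw (esym dc)) _.
by rewrite -[connect _ _ _]/(iso_conn _ _) iso_conn_sym; apply: half; rewrite // dc.
Qed.

Lemma herm_vtx_diff A B : vtx A -> is_herm B ->
  is_herm ((B - A) *m invmx A *m B).
Proof.
case/andP=> /is_hermP hA uA /is_hermP hB; apply/is_hermP.
rewrite !starM starB star_inv hA hB mulmxA mulmxBr mulmxKV //.
by rewrite !mulmxBl mulmxV // mul1mx.
Qed.

(** Induction on the distance rank (B - A) from an arbitrary vertex A to B, where the
  class of B is entered from A along an anisotropic line.  The step from A to
  A' = A + p^-1 [u], u = D w with D = B - A and p = (star w) D w, lowers the rank
  of the difference; A' is nonsingular when (star w) D A^-1 B w is nonzero.  A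
  direction y generic for A and A' leads from both into the class of B, to two
  points of one nondegenerate pencil. *)
Lemma iso_conn_near r A B x a : (\rank (B - A)%R <= r)%N -> vtx A -> vtx B -> a \in K ->
  invform A x x != 0 -> vtx (A + a *: dyad x) -> \det (A + a *: dyad x) = \det B ->
  iso_conn (A + a *: dyad x) B.
Proof.
elim: r A x a => [|r IH] A x a rAB vA vB aK gx vx dx; have [hA uA] := andP vA;
  have [hB uB] := andP vB; set D := B - A in rAB.
  move: rAB; rewrite leqn0 mxrank_eq0 subr_eq0 => /eqP e; move: dx.
  rewrite e det_add_dyad // -[RHS]mulr1 => /(mulfI (vtx_det vA)) /(canRL (addKr _)).
  rewrite addNr => /eqP; rewrite mulf_eq0 (negPf gx) orbF => /eqP->.
  by rewrite scale0r addr0 /iso_conn connect0.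
have [D0|D0] := eqVneq D 0; first by apply: IH => //; rewrite -/D D0 mxrank0.
have hD : is_herm D by apply: hermB.
have hDB := herm_vtx_diff vA hB; rewrite -/D in hDB.
have DB0 : D *m invmx A *m B != 0.
  apply: contra D0 => /eqP e; rewrite -[D](mulmxKV uA) -[X in X *m A](mulmxK uB) e.
  by rewrite !mul0mx.
have [w [wD _ wDB]] := generic_vector hD hD hDB D0 D0 DB0.
pose p := hval D w; pose u := D *m w.
have u0 : u != 0.
  by apply: contra wD => /eqP e; rewrite /hval -mulmxA -/u e mulmx0 mxE.
have pK : p \in K by apply/fixfP; rewrite /p /hval -sesqui_bar.
have su : star u = star w *m D by rewrite /u starM (is_hermP _ hD).
pose A' := A + p^-1 *: dyad u.
have hA' : is_herm A' by apply: herm_add_dyad; rewrite ?fixfV.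
have dA' : \det A' = \det A * (hval (D *m invmx A *m B) w / p).
  rewrite /A' det_add_dyad //; congr (_ * _).
  have -> : hval (D *m invmx A *m B) w = p + invform A u u.
    rewrite /p /hval /invform su /u; have -> : B = A + D by rewrite /D addrC subrK.
    by rewrite mulmxDr mulmxKV // mulmxDr mulmxDl mxE !mulmxA.
  by rewrite mulrDl mulfV // mulrC.
have vA' : vtx A'.
  by apply: vtxP; rewrite // dA' !mulf_neq0 ?invr_eq0 // vtx_det.
have uA' := vtx_unit vA'.
have rA' : (\rank (B - A')%R <= r)%N.
  rewrite -ltnS; apply: leq_trans rAB; apply: rank_ltmx; rewrite ltmxE.
  have e : B - A' = D - p^-1 *: dyad u by rewrite /A' opprD addrA.
  rewrite e; apply/andP; split.
    have -> : D - p^-1 *: dyad u = (1%:M - p^-1 *: (u *m star w)) *m D.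
      by rewrite mulmxBl mul1mx -scalemxAl -mulmxA -su.
    exact: submxMl.
  apply/negP => /submxP[Z DZ]; move/eqP: (wD); apply; rewrite /hval -mulmxA DZ -mulmxA mulmxBl.
  rewrite -/u -scalemxAl /dyad -mulmxA su mulmx_11r scalerA mulVf // scale1r subrr.
  by rewrite !mulmx0 mxE.
have [y [gy gy' uy]] := generic_vector (hermV hA) (hermV hA') (herm_gram_mx u hA)
  (invmx_neq0 vA) (invmx_neq0 vA') (gram_mx_neq0 vA u0).
rewrite -/(invform A y y) in gy; rewrite -/(invform A' y y) in gy'; rewrite hval_gram_mx in uy.
have detK C : is_herm C -> \det C \in K.
  by move=> /is_hermP hC; apply/fixfP; rewrite -det_star hC.
pose b C := (\det B / \det C - 1) / invform C y y.
have bK C : is_herm C -> b C \in K.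
  move=> hC; apply: fixfM; last by rewrite fixfV ?invform_fixf.
  by rewrite fixfD ?fixfN ?fixf1 // fixfM ?fixfV ?detK.
have db C : vtx C -> invform C y y != 0 -> \det (C + b C *: dyad y) = \det B.
  move=> vC gC; rewrite det_add_dyad ?(vtx_unit vC) // /b divfK // addrC subrK mulrC divfK //.
  exact: vtx_det.
have vb C : vtx C -> invform C y y != 0 -> vtx (C + b C *: dyad y).
  move=> vC gC; apply: vtxP; last by rewrite db // vtx_det.
  by apply: herm_add_dyad; rewrite ?bK ?(vtx_herm vC).
apply: connect_trans (_ : connect iso_adj (A + a *: dyad x) (A + b A *: dyad y)) _.
  by apply: iso_conn_star; rewrite ?bK ?vb ?db.
apply: connect_trans (_ : connect iso_adj _ (A' + b A' *: dyad y)) _; last first.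
  by apply: IH; rewrite ?bK ?vb ?db.
have piK : p^-1 \in K by rewrite fixfV.
rewrite {1}/A' -addrA -(lift2_e1 u y piK) -!(lift2_e2 u y) ?bK // -lift2D.
apply: iso_conn_pencil; rewrite ?herm2D ?herm2_ray ?bK //.
  by rewrite lift2_e2 ?bK ?vb.
rewrite lift2D lift2_e1 // !lift2_e2 ?bK // addrA -/A'.
by rewrite !db.
Qed.

Theorem det_class_connected A B : vtx A -> vtx B -> \det A = \det B -> iso_conn A B.
Proof.
move=> vA vB dAB; have [hA uA] := andP vA.
have [x gx] := hval_neq0 (hermV hA) (invmx_neq0 vA).
have := @iso_conn_near (\rank (B - A)) A B x 0 (leqnn _) vA vB fixf0 gx.
by rewrite scale0r addr0; apply.
Qed.

(** * Lines, neighbours and congruence *)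

Definition line_set A x : {set 'M[F]_n} := [set A + s *: dyad x | s in K].

Lemma card_line_set A x : (#|line_set A x| <= q)%N.
Proof. by rewrite -card_fixf leq_imset_card. Qed.

Lemma base_line_set A x : A \in line_set A x.
Proof. by apply/imsetP; exists 0; rewrite ?fixf0 // scale0r addr0. Qed.

Lemma isotropic_of_det A s x : vtx A -> s != 0 -> \det (A + s *: dyad x) = \det A ->
  invform A x x = 0.
Proof.
move=> vA s0; rewrite det_add_dyad ?(vtx_unit vA) // -[RHS]mulr1 => /(mulfI (vtx_det vA)) e.
by apply: (mulfI s0); apply: (addrI 1); rewrite e mulr0 addr0.
Qed.

Lemma rank1_diff A B : is_herm A -> is_herm B -> \rank (B - A) = 1%N ->
  exists s x, [/\ s \in K, s != 0, x != 0 & B = A + s *: dyad x].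
Proof.
move=> hA hB r1; have hD := hermB hB hA.
have [|s [x [sK nz e]]] := herm_rank1 hD; first by rewrite r1.
have /andP[s0 x0] : (s != 0) && (x != 0) by apply: nz; rewrite -mxrank_eq0 r1.
by exists s, x; split; rewrite // -e addrC subrK.
Qed.

(** The two rank-one matrices D - B and D - C differ by a multiple of [x], so they are
  multiples of [x] themselves.  This is why the maximal cliques are lines. *)
Lemma line_set_max A x B C D : is_herm A -> x != 0 -> B \in line_set A x -> C \in line_set A x ->
  B != C -> is_herm D -> \rank (D - B) = 1%N -> \rank (D - C) = 1%N -> D \in line_set A x.
Proof.
move=> hA x0 /imsetP[b bK ->] /imsetP[c cK ->] bc hD rB rC.
have hb := herm_add_dyad x hA bK; have hc := herm_add_dyad x hA cK.
have [s [y [sK s0 y0 De]]] := rank1_diff hb hD rB.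
have cb0 : c - b != 0 by rewrite subr_eq0; apply: contra bc => /eqP ->.
have cbK : c - b \in K by rewrite fixfD ?fixfN.
have [|k xy] := rank1_difference_collinear cb0 x0 y0 cbK sK _ s0.
  rewrite (_ : _ - _ = D - (A + c *: dyad x)) ?rC // De scalerBl.
  by apply/matrixP => i j; rewrite !mxE; ring.
have k0 : k != 0 by apply: contra x0 => /eqP k0; rewrite xy k0 scale0r.
apply/imsetP; exists (b + s * N k^-1); first by rewrite fixfD // fixfM // nrm_fixf.
have ky : k^-1 *: x = y by rewrite xy scalerA mulVf // scale1r.
by rewrite De scalerDl -scalerA -dyadZ ky addrA.
Qed.

Lemma rank_line A s t x : x != 0 -> s != t -> \rank ((A + s *: dyad x) - (A + t *: dyad x)) = 1%N.
Proof.
move=> x0 st; rewrite opprD addrACA subrr add0r -scalerBl.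
by apply: rank_dyad; rewrite ?subr_eq0.
Qed.

Lemma rank_line0 A s x : x != 0 -> s != 0 -> \rank ((A + s *: dyad x) - A) = 1%N.
Proof. by move=> x0 s0; rewrite addrAC subrr add0r rank_dyad. Qed.

Definition cong (P A : 'M[F]_n) := P *m A *m star P.
Definition nbrs A := [set B | iso_adj A B].
Definition det_class (c : F) : {set 'M[F]_n} := [set A | vtx A & \det A == c].

Lemma cong_herm (P : 'M_n) A : is_herm A -> is_herm (cong P A).
Proof. by move=> /is_hermP hA; apply/is_hermP; rewrite /cong !starM starK hA mulmxA. Qed.

Lemma det_cong (P : 'M_n) A : \det (cong P A) = N (\det P) * \det A.
Proof. by rewrite /cong !det_mulmx det_star /nrm mulrAC. Qed.

Lemma star_unit (P : 'M_n) : (star P \in unitmx) = (P \in unitmx).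
Proof. by rewrite !unitmxE det_star !unitfE fmorph_eq0. Qed.

Lemma cong_inj (P : 'M_n) : P \in unitmx -> injective (cong P).
Proof.
move=> uP A B; rewrite /cong => /(can_inj (mulmxK (_ : star P \in unitmx))) e.
by apply: (can_inj (mulKmx uP)); apply: e; rewrite star_unit.
Qed.

Lemma cong_vtx (P : 'M_n) A : P \in unitmx -> vtx A -> vtx (cong P A).
Proof.
move=> uP vA; apply: vtxP; first exact/cong_herm/vtx_herm.
by rewrite det_cong mulf_neq0 ?nrm_eq0 -?unitfE -?unitmxE ?(vtx_unit vA).
Qed.

Lemma cong_iso_adj (P : 'M_n) A B : P \in unitmx -> iso_adj A B -> iso_adj (cong P A) (cong P B).
Proof.
move=> uP /and4P[vA vB rAB /eqP dAB]; rewrite /iso_adj !cong_vtx //= !det_cong dAB eqxx andbT.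
rewrite /cong -mulmxBl -mulmxBr mxrankMfree ?row_free_unit ?star_unit //.
by rewrite -mxrank_tr trmx_mul mxrankMfree ?mxrank_tr // row_free_unit unitmx_tr.
Qed.

Lemma card_nbrs_cong (P : 'M_n) A : P \in unitmx -> (#|nbrs A| <= #|nbrs (cong P A)|)%N.
Proof.
move=> uP; rewrite -(card_imset (nbrs A) (cong_inj uP)); apply/subset_leq_card/subsetP.
by move=> _ /imsetP[B + ->]; rewrite !inE; apply: cong_iso_adj.
Qed.

(** With x isotropic, (1 + a [x] A^-1) transforms A into A + (a + bar a)[x], and the
  trace is onto K. *)
Lemma iso_adj_cong A B : iso_adj A B -> exists2 P : 'M_n, P \in unitmx & B = cong P A.
Proof.
case/and4P=> vA vB /eqP rD /eqP dD; have [hA uA] := andP vA.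
have [s [x [sK s0 x0 De]]] : exists s x, [/\ s \in K, s != 0, x != 0 & B = A + s *: dyad x].
  by apply: rank1_diff; rewrite ?(vtx_herm vB) // -mxrank_opp opprB.
have gx : invform A x x = 0 by apply: (isotropic_of_det vA s0); rewrite -De.
have [a as_] := trace_surj sK.
pose P : 'M_n := 1%:M + a *: (x *m star x *m invmx A).
have BP : B = cong P A.
  rewrite /cong /P starD star1 starZ !starM starK star_inv (is_hermP _ hA).
  rewrite mulmxDl mul1mx -scalemxAl mulmxKV // mulmxDr mulmx1 mulmxDl.
  rewrite -!scalemxAl -!scalemxAr !mulmxA mulmxV // mul1mx.
  have -> : x *m star x *m invmx A *m x = 0.
    by rewrite -!mulmxA [star x *m _]mulmxA mulmx_11r -/(invform A x x) gx scale0r.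
  by rewrite mul0mx !scaler0 addr0 De -as_ scalerDl addrA.
exists P => //; move: (vtx_det vB); rewrite BP det_cong mulf_eq0 nrm_eq0 negb_or.
by case/andP; rewrite -unitfE -unitmxE.
Qed.

Lemma cong_to_det A c : vtx A -> c \in K -> c != 0 ->
  exists2 P : 'M_n, P \in unitmx & \det (cong P A) = c.
Proof.
move=> vA cK c0.
have dK : c / \det A \in K.
  by rewrite fixfM // fixfV //; apply/fixfP; rewrite -det_star (is_hermP _ (vtx_herm vA)).
have [l lc] := nrm_surj dK.
have dl : exists P : 'M[F]_n, \det P = l.
  have n0 : (0 < n)%N by apply: ltnW.
  pose i := Ordinal n0.
  exists (diag_mx (\row_j (if j == i then l else 1))).
  rewrite det_diag (bigD1 i) //= big1 ?mxE ?eqxx ?mulr1 // => j ji.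
  by rewrite mxE (negPf ji).
have [P Pl] := dl; exists P; last by rewrite det_cong Pl lc divfK // (vtx_det vA).
by rewrite unitmxE unitfE Pl -nrm_eq0 lc mulf_neq0 // invr_eq0 (vtx_det vA).
Qed.

Lemma iso_conn_nbrs A B : iso_conn A B -> #|nbrs A| = #|nbrs B|.
Proof.
have le C D : iso_adj C D -> (#|nbrs C| <= #|nbrs D|)%N.
  by case/iso_adj_cong=> P uP ->; apply: card_nbrs_cong.
have sym C D : iso_adj C D -> iso_adj D C.
  case/and4P=> vC vD /eqP r /eqP d; rewrite /iso_adj vC vD d eqxx -mxrank_opp opprB r.
  by rewrite eqxx.
case/connectP=> p; elim: p A => [|C p IH] A /=; first by move=> _ ->.
case/andP=> AC pC Bl; rewrite -(IH C pC Bl); apply/eqP.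
by rewrite eqn_leq !le // sym.
Qed.

Lemma vtx_detK A : vtx A -> \det A \in K.
Proof. by move=> vA; apply/fixfP; rewrite -det_star (is_hermP _ (vtx_herm vA)). Qed.

(** Any two vertices are congruent: a congruence adjusts the determinant, and the
  steps of an iso_adj-path are congruences. *)
Lemma nbrs_regular A B : vtx A -> vtx B -> #|nbrs A| = #|nbrs B|.
Proof.
have le C D : vtx C -> vtx D -> (#|nbrs C| <= #|nbrs D|)%N.
  move=> vC vD; have [P uP dP] := cong_to_det vC (vtx_detK vD) (vtx_det vD).
  apply: leq_trans (card_nbrs_cong C uP) _.
  by rewrite (iso_conn_nbrs (det_class_connected (cong_vtx uP vC) vD dP)).
by move=> vA vB; apply/eqP; rewrite eqn_leq !le.
Qed.

Lemma card_det_class A B : vtx A -> vtx B -> #|det_class (\det A)| = #|det_class (\det B)|.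
Proof.
have le C D : vtx C -> vtx D -> (#|det_class (\det C)| <= #|det_class (\det D)|)%N.
  move=> vC vD; have [P uP dP] := cong_to_det vC (vtx_detK vD) (vtx_det vD).
  rewrite -(card_imset _ (cong_inj uP)); apply/subset_leq_card/subsetP.
  move=> _ /imsetP[X + ->]; rewrite !inE => /andP[vX /eqP dX].
  by rewrite cong_vtx //= -dP !det_cong dX.
by move=> vA vB; apply/eqP; rewrite eqn_leq !le.
Qed.

(** For each y anisotropic for C, the point C + b[y] of determinant det B would be a
  neighbour of B, so that R - b[y] has rank one, with R = B - C and b = k / g(y).
  If R is singular, a generic y outside the range of R is a contradiction.  If R is
  nonsingular then n = 2, and det (R - b[y]) = 0 says that the forms of C^-1 and
  k R^-1 agree at all y anisotropic for C.  So R = k C and B = (1 + k) C, whose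
  determinant (1 + k)^2 det C should be (1 + k) det C. *)
Lemma no_twin_in_other_class B C : vtx B -> vtx C -> \det B != \det C ->
  ~ (forall D, vtx D -> \det D = \det B -> \rank (D - C) = 1%N -> \rank (D - B) = 1%N).
Proof.
move=> vB vC dBC nbrBC; have [[hB uB] [hC uC]] := (andP vB, andP vC).
pose k := \det B / \det C - 1.
have dC := vtx_det vC.
have k1 : \det B = \det C * (1 + k) by rewrite /k addrC subrK mulrC divfK.
have k0 : k != 0 by apply: contra dBC => /eqP k0; rewrite k1 k0 addr0 mulr1.
have kK : k \in K by rewrite !(fixfD, fixfN, fixfM, fixfV) ?fixf1 ?vtx_detK.
pose b y := k / invform C y y.
have bK y : b y \in K by rewrite fixfM // fixfV // invform_fixf.
pose R := B - C; have hR : is_herm R by apply: hermB.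
have R0 : R != 0 by apply: contra dBC; rewrite subr_eq0 => /eqP ->.
have rR y : invform C y y != 0 -> \rank (R - b y *: dyad y) = 1%N.
  move=> gy; have y0 : y != 0.
    by apply: contra gy => /eqP->; rewrite /invform mulmx0 mxE.
  have by0 : b y != 0 by rewrite /b mulf_neq0 // invr_eq0.
  have dD : \det (C + b y *: dyad y) = \det B by rewrite det_add_dyad // /b divfK // -k1.
  have vD : vtx (C + b y *: dyad y).
    by apply: vtxP; [apply: herm_add_dyad | rewrite dD (vtx_det vB)].
  rewrite /R -addrA -opprD -mxrank_opp opprB.
  by apply: nbrBC => //; apply: rank_line0.
have [uR|nuR] := boolP (R \in unitmx).
  have n2 : n = 2%N.
    have [y] := hval_neq0 (hermV hC) (invmx_neq0 vC).
    rewrite -/(invform C y y) => /rR r1; apply/eqP; rewrite eqn_leq n_ge2 andbT.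
    rewrite -(mxrank_unit uR) -(subrK (b y *: dyad y) R).
    apply: leq_trans (mxrank_add _ _) _; rewrite r1 (leq_add (leqnn 1)) //.
    by apply: leq_trans (mxrank_scale _ _) _; apply: mulmx_max_rank.
  have CR : invmx C = k *: invmx R.
    apply/eqP; rewrite -subr_eq0; apply: contraT => H0.
    have hH : is_herm (invmx C - k *: invmx R).
      by apply: hermB; [apply: hermV | apply: hermZ => //; apply: hermV].
    have [y [gy _ Hy]] := generic_vector (hermV hC) (hermV hC) hH
      (invmx_neq0 vC) (invmx_neq0 vC) H0.
    rewrite -/(invform C y y) in gy; have r1 := rR y gy.
    have : \det (R - b y *: dyad y) == 0.
      apply: contraT => d; have : R - b y *: dyad y \in unitmx by rewrite unitmxE unitfE.
      by move/mxrank_unit; rewrite r1 n2.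
    rewrite -scaleNr det_add_dyad // mulf_eq0 -[\det R == 0]negbK -unitfE -unitmxE uR /=.
    rewrite mulNr subr_eq0 => /eqP e; move/eqP: Hy; case.
    rewrite /hval mulmxBr mulmxBl -scalemxAr -scalemxAl mxE [fun_of_matrix (- _) _ _]mxE.
    rewrite [fun_of_matrix (_ *: _) _ _]mxE -/(invform C y y) -/(invform R y y).
    have -> : invform C y y = k * invform R y y.
      by rewrite -[LHS]mulr1 e /b mulrA [_ * (k / _)]mulrC divfK.
    by rewrite subrr.
  have RC : R = k *: C.
    by rewrite -[R]mulmx1 -(mulVmx uC) CR -scalemxAl -scalemxAr mulmxA mulmxV // mul1mx.
  have BC : B = (1 + k) *: C by rewrite scalerDl scale1r -RC /R addrC subrK.
  have sqr : (1 + k) ^+ n = (1 + k) * (1 + k) by rewrite n2 expr2.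
  have := k1; rewrite {1}BC detZ sqr mulrC => /(mulfI dC) e.
  have k10 : 1 + k != 0 by apply: contra (vtx_det vB) => /eqP h; rewrite k1 h mulr0.
  by move/eqP: k0; apply; apply: (addrI 1); rewrite addr0; apply: (mulfI k10); rewrite e mulr1.
have [w w0 wR] : exists2 w : 'rV_n, w != 0 & w *m R = 0.
  by apply/det0P; move: nuR; rewrite unitmxE unitfE negbK.
have sw0 : dyad (star w) != 0 by rewrite dyad_eq0 star_eq0.
have [y [gy _ wy]] := generic_vector (hermV hC) (hermV hC) (herm_dyad (star w))
  (invmx_neq0 vC) (invmx_neq0 vC) sw0.
rewrite -/(invform C y y) in gy; have r1 := rR y gy.
have hRb : is_herm (R - b y *: dyad y) by rewrite -scaleNr; apply: herm_add_dyad; rewrite ?fixfN.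
have [|s [z [_ nz e]]] := herm_rank1 hRb; first by rewrite r1.
have Re : R = b y *: dyad y + s *: dyad z by rewrite -e addrC subrK.
have {}wy : (w *m y) 0 0 != 0.
  apply: contra wy => /eqP wy; rewrite /hval /dyad starK -mulmxA -[star w *m w *m y]mulmxA.
  by rewrite [w *m y]mx11_scalar wy raddf0 !mulmx0 mxE.
have wz : (b y * (w *m y) 0 0) *: star y = - (s * (w *m z) 0 0) *: star z.
  move: wR; rewrite Re mulmxDr -!scalemxAr !mulmxA !mulmx_11l !scalerA => /eqP.
  by rewrite addr_eq0 scaleNr => /eqP.
have by0 : b y != 0 by rewrite /b mulf_neq0 // invr_eq0.
have yz : y = bar (- (s * (w *m z) 0 0) / (b y * (w *m y) 0 0)) *: z.
  rewrite -[LHS]starK -[X in _ = _ *: X]starK -starZ; congr (star _).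
  have p0 : b y * (w *m y) 0 0 != 0 by rewrite mulf_neq0.
  by apply: (scalerI p0); rewrite wz scalerA [X in _ = X *: _]mulrC divfK.
move: Re yz; set m := bar _ => Re yz.
have Rz : R = (b y * N m + s) *: dyad z by rewrite Re {2}yz dyadZ scalerA scalerDl.
have := wR; rewrite Rz -scalemxAr mulmxA mulmx_11l scalerA => /eqP.
rewrite scaler_eq0 mulf_eq0 => /orP[/orP[/eqP h|/eqP h]|].
- by move/eqP: R0; rewrite Rz h scale0r.
- by move/eqP: wy; rewrite yz -scalemxAr mxE h mulr0.
- by rewrite star_eq0 => /eqP h; move/eqP: R0; rewrite Rz h /dyad mul0mx scaler0.
Qed.

(** * Endomorphisms *)

Section Endomorphism.

Variable phi : 'M[F]_n -> 'M[F]_n.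
Hypothesis phi_vtx : forall A, vtx A -> vtx (phi A).
Hypothesis phi_adj : forall A B, vtx A -> vtx B -> \rank (A - B) = 1%N ->
  \rank (phi A - phi B) = 1%N.

Lemma phi_line_set A b x z : vtx A -> b \in K -> b != 0 -> x != 0 -> z != 0 ->
  vtx (A + b *: dyad x) -> phi (A + b *: dyad x) \in line_set (phi A) z ->
  forall t, t \in K -> vtx (A + t *: dyad x) -> phi (A + t *: dyad x) \in line_set (phi A) z.
Proof.
move=> vA bK b0 x0 z0 vB BL t tK vt.
have [->|t0] := eqVneq t 0; first by rewrite scale0r addr0 base_line_set.
have [->//|tb] := eqVneq t b.
apply: (line_set_max (vtx_herm (phi_vtx vA)) z0 (base_line_set _ _) BL).
- rewrite eq_sym -subr_eq0 -mxrank_eq0 phi_adj ?rank_line0 //.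
- exact: vtx_herm (phi_vtx vt).
- by rewrite phi_adj ?rank_line0.
- by rewrite phi_adj ?rank_line.
Qed.

(** The q vertices of an isotropic line have q distinct images on one line of the
  target, which therefore consists of vertices only; but an anisotropic line
  contains a singular point. *)
Lemma phi_iso_adj A B : iso_adj A B -> iso_adj (phi A) (phi B).
Proof.
case/and4P=> vA vB /eqP rAB /eqP dAB.
rewrite /iso_adj !phi_vtx // phi_adj ?rAB //=.
have [hA uA] := andP vA.
have [b [x [bK b0 x0 Be]]] : exists s x, [/\ s \in K, s != 0, x != 0 & B = A + s *: dyad x].
  by apply: rank1_diff; rewrite ?(vtx_herm vB) // -mxrank_opp opprB.
have gx : invform A x x = 0.
  by apply: (isotropic_of_det vA b0); rewrite -Be.
have vt t : t \in K -> vtx (A + t *: dyad x).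
  move=> tK; apply: vtxP; first exact: herm_add_dyad.
  by rewrite det_add_dyad // gx mulr0 addr0 mulr1 (vtx_det vA).
have [s [z [sK s0 z0 pB]]] : exists s z, [/\ s \in K, s != 0, z != 0 &
    phi B = phi A + s *: dyad z].
  apply: rank1_diff; rewrite ?(vtx_herm (phi_vtx _)) //.
  by rewrite -mxrank_opp opprB phi_adj.
have onto : line_set (phi A) z = [set phi (A + t *: dyad x) | t in K].
  apply/eqP; rewrite eq_sym eqEcard; apply/andP; split.
    apply/subsetP => _ /imsetP[t tK ->]; apply: (phi_line_set vA bK b0 x0 z0) => //; try exact: vt.
    by rewrite -Be pB; apply: imset_f.
  rewrite (leq_trans (card_line_set _ _)) // card_in_imset ?card_fixf //.
  move=> t t' tK t'K e; apply/eqP; apply: contraT => tt'.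
  by have := phi_adj (vt t tK) (vt t' t'K) (rank_line A x0 tt'); rewrite e subrr mxrank0.
have gz : invform (phi A) z z = 0.
  apply/eqP; apply: contraT => g0.
  have : phi A - (invform (phi A) z z)^-1 *: dyad z \in line_set (phi A) z.
    rewrite -scaleNr; apply: imset_f.
    by rewrite fixfN ?fixfV ?invform_fixf ?(vtx_herm (phi_vtx vA)).
  rewrite onto => /imsetP[t tK e]; have := vtx_det (phi_vtx (vt t tK)).
  rewrite -e -scaleNr det_add_dyad ?(vtx_unit (phi_vtx vA)) // mulNr mulVf // subrr mulr0.
  by rewrite eqxx.
by rewrite pB det_add_dyad ?(vtx_unit (phi_vtx vA)) // gz mulr0 addr0 mulr1.
Qed.

(** If the isotropic neighbours B = A + b[x] and C = A + c[y] had the same image, both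
  isotropic lines would be mapped into the line joining phi A and phi B.  Pull this
  back to 2 x 2 forms, with A at the point h where both coordinate directions are
  isotropic: the inverse of the Gram matrix of x and y if these are not orthogonal,
  and any such h otherwise, since then all A + lift2 x y _ have the determinant of
  A. *)
Lemma phi_local_inj A B C : iso_adj A B -> iso_adj A C -> phi B = phi C -> B = C.
Proof.
move=> AB AC BC.
have nbr D : iso_adj A D ->
    exists s x, [/\ s \in K, s != 0, x != 0, D = A + s *: dyad x & invform A x x = 0].
  case/and4P=> vA vD /eqP rD /eqP dD.
  have [s [x [sK s0 x0 De]]] : exists s x, [/\ s \in K, s != 0, x != 0 & D = A + s *: dyad x].
    by apply: rank1_diff; rewrite ?(vtx_herm vA) ?(vtx_herm vD) // -mxrank_opp opprB.
  by exists s, x; split=> //; apply: (isotropic_of_det vA s0); rewrite -De.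
have [vA vB] : vtx A /\ vtx B by case/and4P: AB.
have vC : vtx C by case/and4P: AC.
have [hA uA] := andP vA.
have [b [x [bK b0 x0 Be gx]]] := nbr B AB; have [c [y [cK c0 y0 Ce gy]]] := nbr C AC.
have AB1 : \rank (phi B - phi A) = 1%N by rewrite phi_adj // Be rank_line0.
have [s [z [sK s0 z0 pB]]] := rank1_diff (vtx_herm (phi_vtx vA)) (vtx_herm (phi_vtx vB)) AB1.
have vs t : t \in K -> vtx (A + t *: dyad x).
  move=> tK; apply: vtxP; rewrite ?herm_add_dyad // det_add_dyad // gx mulr0 addr0 mulr1.
  exact: vtx_det vA.
have vt t : t \in K -> vtx (A + t *: dyad y).
  move=> tK; apply: vtxP; rewrite ?herm_add_dyad // det_add_dyad // gy mulr0 addr0 mulr1.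
  exact: vtx_det vA.
have [/existsP[k /eqP yx]|nxy] := boolP [exists k, y == k *: x].
  apply/eqP; apply: contraT => neq.
  have Ce' : C = A + (c * N k) *: dyad x by rewrite Ce yx dyadZ scalerA.
  have bc : b != c * N k by apply: contra neq => /eqP e; rewrite Be Ce' e.
  by have := phi_adj vB vC; rewrite {1}Be {1}Ce' rank_line // BC subrr mxrank0 => /(_ erefl).
have indep (p : vec) : p != 0 -> p.1 *: x + p.2 *: y != 0.
  case: p => p1 p2 /= p0; apply/eqP => e.
  have [p20|p20] := eqVneq p2 0.
    move/eqP: e; rewrite p20 scale0r addr0 scaler_eq0 (negPf x0) orbF => /eqP p10.
    by move/eqP: p0; apply; rewrite p10 p20.
  move/negP: nxy; apply; apply/existsP; exists (- p1 / p2); apply/eqP.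
  apply: (scalerI p20); rewrite scalerA mulrC divfK // scaleNr.
  by apply/eqP; rewrite -addr_eq0 addrC e.
have [h [vh h1 h2 hV]] : exists h, [/\ vtx2 h, h.1.1 = 0, h.2 = 0 &
    forall u, vtx2 u -> vtx (A + lift2 x y (u - h))].
  have [g0|g0] := eqVneq (invform A x y) 0.
    exists (0, 1, 0); split=> //.
      rewrite /vtx2 /herm2 /det2 /= !fixf0 /= mul0r sub0r oppr_eq0 nrm_eq0.
      exact: oner_neq0.
    move=> u /andP[hu _]; apply: vtxP.
      apply: hermD => //; apply: herm_lift2; apply/herm2D/herm2N => //.
      by rewrite /herm2 /= !fixf0.
    rewrite det_lift2 // gx gy g0 -[invform A y x](invform_bar _ _ hA) g0 rmorph0.
    by rewrite !mulr0 subrr mulr0 !addr0 mulr1 (vtx_det vA).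
  have gr : gram A x y != 0.
    rewrite /gram gx mul0r sub0r oppr_eq0 -[invform A y x](invform_bar _ _ hA).
    by rewrite -/(nrm _) nrm_eq0.
  have hh := gram_inv_herm x y hA.
  exists (gram_inv A x y); split; rewrite /= ?gx ?gy ?mul0r //.
    rewrite /vtx2 hh /=; apply/eqP => d.
    have := @det_pencil A x y (gram_inv A x y) vA gr.
    rewrite d mulr0 subrr /lift2 /= rmorph0 !scale0r !addr0 => /eqP.
    by rewrite (negPf (vtx_det vA)).
  move=> u /andP[hu du]; apply: vtxP.
    by apply: hermD => //; apply: herm_lift2; apply/herm2D/herm2N.
  by rewrite det_pencil // !mulf_neq0 // (vtx_det vA).
pose e (M M' : 'M[F]_n) := [&& is_herm M, is_herm M' & \rank (M - M') == 1%N].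
pose f u := phi (A + lift2 x y (u - h)).
have fE t p : f (h + ray t p) = phi (A + lift2 x y (ray t p)) by rewrite /f [h + _]addrC addrK.
exfalso.
apply: (@two_isotropic_lines _ e (line_set (phi A) z) f _ _ _ _
  h (1, 0) (0, 1)) => //.
- by move=> M; rewrite /e subrr mxrank0 andbF andbF.
- move=> l m t lL mL lm /and3P[ht _ /eqP r1] /and3P[_ _ /eqP r2].
  exact: (line_set_max (vtx_herm (phi_vtx vA)) z0 lL mL).
- exact: card_line_set.
- move=> u w vu vw /andP[uw /eqP duw]; rewrite /e !(vtx_herm (phi_vtx _)) ?hV //=.
  apply/eqP/phi_adj; rewrite ?hV //.
  have [hu hw] : herm2 u /\ herm2 w by split; [case/andP: vu|case/andP: vw].
  have [r [p [rK p0 re]]] := herm2_singular (herm2D hu (herm2N hw)) duw.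
  have r0 : r != 0 by apply: contra uw => /eqP r0; rewrite -subr_eq0 re r0 ray0.
  rewrite opprD addrACA subrr add0r -lift2N -lift2D opprB addrA subrK re.
  by rewrite lift2_ray // rank_dyad // indep.
- by rewrite /slope h1 h2 /nrm /= !(rmorph0, rmorph1); ring.
- by rewrite /slope h1 h2 /nrm /= !(rmorph0, rmorph1); ring.
- by rewrite /wedge /= mulr1 mulr0 subr0 nrm_eq0 oner_neq0.
- move=> t tK; rewrite fE lift2_e1 // => vht.
  apply: (phi_line_set vA bK b0 x0 z0 (vs b bK)) => //; last exact: vs.
  by rewrite -Be pB; apply: imset_f.
- move=> t tK; rewrite fE lift2_e2 // => vht.
  apply: (phi_line_set vA cK c0 y0 z0 (vt c cK)) => //; last exact: vt.
  by rewrite -Ce -BC pB; apply: imset_f.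
Qed.

Lemma phi_nbrs A : vtx A -> phi @: nbrs A = nbrs (phi A).
Proof.
move=> vA; apply/eqP; rewrite eqEcard; apply/andP; split.
  apply/subsetP => _ /imsetP[B + ->]; rewrite !inE.
  exact: phi_iso_adj.
rewrite card_in_imset ?(nbrs_regular (phi_vtx vA) vA) // => B C; rewrite !inE.
exact: phi_local_inj.
Qed.

Lemma phi_det A B : vtx A -> vtx B -> \det A = \det B -> \det (phi A) = \det (phi B).
Proof.
move=> vA vB dAB.
have /connectP[p] := det_class_connected vA vB dAB.
elim: p A {vA dAB} => [|C p IH] A /=; first by move=> _ ->.
case/andP=> AC pC Bl; rewrite -(IH C pC Bl).
by case/and4P: (phi_iso_adj AC) => _ _ _ /eqP.
Qed.

(** The image of a class is closed under iso_adj because phi maps neighbourhoods onto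
  neighbourhoods, so it contains a whole class; the sizes are equal. *)
Lemma phi_class_inj A B : vtx A -> vtx B -> \det A = \det B -> phi A = phi B -> A = B.
Proof.
move=> vA vB dAB.
pose S := phi @: det_class (\det A).
have S_closed X Y : iso_adj X Y -> X \in S -> Y \in S.
  move=> XY /imsetP[X']; rewrite inE => /andP[vX' /eqP dX'] eX.
  have : Y \in phi @: nbrs X' by rewrite phi_nbrs // -eX inE.
  case/imsetP=> Y'; rewrite inE => /and4P[_ vY' _ /eqP dY'] ->.
  by apply: imset_f; rewrite inE vY' -dY' dX' eqxx.
have Sall : det_class (\det (phi A)) \subset S.
  apply/subsetP => Y; rewrite inE => /andP[vY /eqP dY].
  have AY := det_class_connected (phi_vtx vA) vY (esym dY).
  have cl := intro_closed iso_conn_sym S_closed.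
  rewrite -(closed_connect cl AY); apply: imset_f.
  by rewrite inE vA eqxx.
have inj : {in det_class (\det A) &, injective phi}.
  apply/imset_injP; rewrite eqn_leq leq_imset_card /=.
  by rewrite (card_det_class vA (phi_vtx vA)) subset_leq_card.
by apply: inj; rewrite inE ?vA ?vB ?dAB eqxx.
Qed.

(** If A and B of different determinants had the same image, each neighbour D of B in
  the class of A would be mapped to an iso_adj-neighbour of phi A, hence be a
  neighbour of A. *)
Lemma phi_inj A B : vtx A -> vtx B -> phi A = phi B -> A = B.
Proof.
move=> vA vB pAB; have [dAB|dAB] := eqVneq (\det A) (\det B); first exact: phi_class_inj.
case: (no_twin_in_other_class vA vB dAB) => D vD dD rD.
have : phi D \in phi @: nbrs A.
  rewrite phi_nbrs // inE /iso_adj !phi_vtx // (phi_det vD vA dD) eqxx.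
  by rewrite pAB -mxrank_opp opprB phi_adj.
case/imsetP=> D'; rewrite inE => /and4P[_ vD' /eqP rD' /eqP dD'] e.
have -> : D = D' by apply: phi_class_inj; rewrite // dD dD'.
by rewrite -mxrank_opp opprB.
Qed.

End Endomorphism.

End Matrices.

End QuadraticInvolution.

Theorem theorem1p1 (q : nat)
    (q_pp : exists p k : nat, [/\ prime p, 0 < k & q = p ^ k])
    (q_ge4 : 4 <= q) (n : nat) (n_ge2 : 2 <= n)
    (F : finFieldType) (cardF : #|F| = q ^ 2) :
  is_core (HGL F q n).
Proof.
have [bar barE] := power_involution q_pp cardF.
have vtxE (A : 'M[F]_n) : hermitian q A && (A \in unitmx) = vtx bar A.
  rewrite /vtx /is_herm; suff -> : star bar A = conj_trmx q A by [].
  by congr trmx; apply: eq_map_mx => x; rewrite barE.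
move=> Phi Phi_hom; pose V := HGL_vertex F q n.
(* Phi as a map on matrices, extended by the identity outside the vertex set. *)
pose phi (A : 'M[F]_n) := if insub A is Some u then \val (Phi (u : V)) else A.
have phiE (u : V) : phi (\val u) = \val (Phi u) by rewrite /phi valK.
have vertexP A : vtx bar A -> exists u : V, A = \val u.
  by rewrite -vtxE => vA; exists (exist _ A vA).
have phi_vtx A : vtx bar A -> vtx bar (phi A).
  by case/vertexP=> u ->; rewrite phiE -vtxE (valP (Phi u)).
have phi_adj A B : vtx bar A -> vtx bar B -> \rank (A - B)%R = 1 ->
    \rank (phi A - phi B)%R = 1.
  move=> /vertexP[u ->] /vertexP[v ->] uv; rewrite !phiE.
  by apply/eqP; apply: Phi_hom; rewrite /= /HGL_edge uv.
have Phi_inj : injective Phi.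
  move=> u v Puv; apply: val_inj.
  apply: (phi_inj barE cardF q_ge4 n_ge2 phi_vtx phi_adj); rewrite -?vtxE ?(valP u) ?(valP v) //.
  by rewrite !phiE Puv.
split=> //.
exact: (@finite_endo_auto V (@HGL_edge F q n) Phi Phi_inj Phi_hom).
Qed.
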